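(* Consider the linear control system $\dot x(t)=Ax(t)+Bu(t)$, $u(t)\in U$, with $A\in\mathbb{R}^{d\times d}$, $B\in\mathbb{R}^{d\times m}$ and compact convex control range $U\subset\mathbb{R}^m$ with $\mathrm{int}\,U\neq\varnothing$. Let $Q\subset\mathbb{R}^d$ be compact and let $f\in C(U,\mathbb{R})$ be such that there are $u_0\in U$ and $x_0\in\mathrm{int}\,Q$ with $f(u_0)=\min_{u\in U}f(u)$ and $Ax_0+Bu_0=0$. Assume that there is $T_0>0$ such that for every $x\in Q$ there are $T\in(0,T_0]$ and $\omega\in\mathcal{U}$ with $$\varphi(T,x,\omega)=x_0\quad\text{and}\quad\varphi(t,x,\omega)\in Q\text{ for all }t\in(0,T].$$ Then the outer invariance pressure satisfies $$P_{out}(f,Q)=f(u_0)+h_{inv,out}(Q)=f(u_0)+\sum_{i=1}^{d}\max(0,\operatorname{Re}\mu_i),$$ where the sum runs over all eigenvalues $\mu_1,\dots,\mu_d$ of $A$ (counted with algebraic multiplicity).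
   Context: $\mathcal{U}$ is the set of Lebesgue integrable functions $\omega:\mathbb{R}\to U$ (i.e. measurable and locally integrable; automatic measurability suffices for bounded $U$). For $x\in\mathbb{R}^d$ and $\omega\in\mathcal{U}$ the solution is $\varphi(t,x,\omega)=e^{At}x+\int_0^te^{A(t-s)}B\omega(s)\,ds$, $t\ge0$. $C(U,\mathbb{R})$ is the set of continuous functions $U\to\mathbb{R}$. For $\varepsilon>0$ let $N_\varepsilon(Q)=\{y\in\mathbb{R}^d:\text{there is }x\in Q\text{ with }d(x,y)<\varepsilon\}$ ($d$ the Euclidean distance). For $\tau>0$, a set $\mathcal{S}\subset\mathcal{U}$ is $(\tau,Q,N_\varepsilon(Q))$-spanning if for all $x\in Q$ there is $\omega\in\mathcal{S}$ with $\varphi(t,x,\omega)\in N_\varepsilon(Q)$ for all $t\in[0,\tau]$. Outer invariance entropy: $r_{inv}(\tau,\varepsilon,Q)$ is the minimal number of elements of a $(\tau,Q,N_\varepsilon(Q))$-spanning set, $h_{inv}(\varepsilon,Q)=\limsup_{\tau\to\infty}\frac1\tau\log r_{inv}(\tau,\varepsilon,Q)$, and $h_{inv,out}(Q)=\lim_{\varepsilon\to0}h_{inv}(\varepsilon,Q)$. Outer invariance pressure: for $f\in C(U,\mathbb{R})$ let $(S_\tau f)(\omega)=\int_0^\tau f(\omega(t))\,dt$, $a_\tau(\varepsilon,f,Q)=\inf\{\sum_{\omega\in\mathcal{S}}e^{(S_\tau f)(\omega)}:\mathcal{S}\ (\tau,Q,N_\varepsilon(Q))\text{-spanning}\}$,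 $P_{inv}(\varepsilon,f,Q)=\limsup_{\tau\to\infty}\frac1\tau\log a_\tau(\varepsilon,f,Q)$, and $P_{out}(f,Q)=\lim_{\varepsilon\to0}P_{inv}(\varepsilon,f,Q)$. *)

(* Defs.v *)
From mathcomp Require Import all_boot all_order all_algebra.
From mathcomp Require Import all_classical all_reals all_analysis.
From mathcomp Require Import complex.

Set Implicit Arguments.
Unset Strict Implicit.
Unset Printing Implicit Defensive.

Import Order.TTheory GRing.Theory Num.Theory.
Import numFieldNormedType.Exports.

Local Open Scope classical_set_scope.
Local Open Scope ring_scope.

(* The real line with the sigma-algebra of Lebesgue measurable sets (the
   carrier of completed_lebesgue_measure), as opposed to the Borel one. *)
Notation lebesgueR R := (caratheodory_type ((@wlength R idfun)^*)%mu).

Section LinearControlSystem.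
Context {R : realType}.

Local Notation lambda := (@completed_lebesgue_measure R).

Definition expmx {n : nat} (M : 'M[R]_n) : 'M[R]_n :=
  limn (series (fun k : nat => (k`!%:R)^-1 *: M ^+ k)).

Definition euclidean_dist {n : nat} (x y : 'cV[R]_n) : R :=
  Num.sqrt (\sum_i (x i 0 - y i 0) ^+ 2).

Definition nbhd {n : nat} (eps : R) (Q : set 'cV[R]_n) : set 'cV[R]_n :=
  [set y | exists2 x, Q x & euclidean_dist x y < eps].

Context {d m : nat}.
Implicit Types (A : 'M[R]_d) (B : 'M[R]_(d, m)) (U : set 'cV[R]_m)
  (Q : set 'cV[R]_d) (f : 'cV[R]_m -> R) (w : R -> 'cV[R]_m)
  (S : set (R -> 'cV[R]_m)).

(* Vector-valued measurability and integrability are componentwise. *)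
Definition controls U : set (R -> 'cV[R]_m) :=
  [set w | (forall t, U (w t)) /\
    forall i, measurable_fun [set: lebesgueR R] (fun t : lebesgueR R => w t i 0)
      /\ forall a b : R,
           lambda.-integrable `[a, b] (fun t => (w t i 0)%:E)].

Definition phi A B (t : R) (x : 'cV[R]_d) w : 'cV[R]_d :=
  expmx (t *: A) *m x +
  \col_i \int[lambda]_(s in `[0, t])
    (expmx ((t - s) *: A) *m B *m w s) i 0.

Definition spanning A B U (tau eps : R) Q S :=
  S `<=` controls U /\
  forall x, Q x -> exists2 w, S w &
    forall t, 0 <= t <= tau -> nbhd eps Q (phi A B t x w).

(* Equal to +oo if there is no finite spanning set. *)
Definition r_inv A B U (tau eps : R) Q : \bar R :=
  ereal_inf [set (n%:R)%:E | n in
    [set n : nat | exists2 S, spanning A B U tau eps Q S & (S #= `I_n)%card]].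

Definition h_inv A B U (eps : R) Q : \bar R :=
  limf_esup (fun tau : R => (tau^-1)%:E * lne (r_inv A B U tau eps Q))%E
    (pinfty_nbhs R).

(* h_inv is nonincreasing in eps, so the limit exists in \bar R. *)
Definition h_inv_out A B U Q : \bar R :=
  lim (h_inv A B U eps Q @[eps --> 0^'+]).

Definition S_int f (tau : R) w : R :=
  \int[lambda]_(t in `[0, tau]) f (w t).

Definition a_inv A B U (tau eps : R) f Q : \bar R :=
  ereal_inf [set (\esum_(w in S) (expR (S_int f tau w))%:E)%E | S in
    [set S | spanning A B U tau eps Q S]].

Definition P_inv A B U (eps : R) f Q : \bar R :=
  limf_esup (fun tau : R => (tau^-1)%:E * lne (a_inv A B U tau eps f Q))%E
    (pinfty_nbhs R).

Definition P_out A B U f Q : \bar R :=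
  lim (P_inv A B U eps f Q @[eps --> 0^'+]).

(* The d complex roots of the characteristic polynomial, listed with
   multiplicity. *)
Definition eigenvalues A : seq R[i] :=
  sval (closed_field_poly_normal (char_poly (map_mx (real_complex R) A))).

End LinearControlSystem.

(* Main.v *)
(** Two solutions driven by the same control differ by e^{tA} applied to the
    difference of their initial values, so both inequalities reduce to counting
    for the linear flow e^{tA}. Over the complex numbers this flow is made lower
    triangular, with eigenvalues sorted by decreasing real part and
    off-diagonal entries as small as desired; its j-th column then grows at
    most like exp(t (Re mu_j + delta)), and its j-th diagonal entry has modulus
    exactly exp(t Re mu_j). A point of C^d is a pair of points of R^d, so counts
    in C^d are squares of counts in R^d.

    Lower bound: all final states lie in a bounded set, whereas two distinct
    points of a suitable product grid inside Q are torn apart by the flow;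
    hence the grid injects into the pairs of controls of a spanning set.
    This replaces the volume growth argument.

    Upper bound: a maximal subset of Q separated up to time tau is small,
    because a product partition into boxes of side exp(- tau max(0, Re mu_j))
    meets it at most once per cell. Each of its points x is steered to x0 inside
    Q in time at most T0 and rests there with the constant control u0; the same
    control keeps every point close to x up to time tau near Q.

    The integral of f along a control is at least f(u0) tau, and it exceeds this
    by at most a constant for the steered controls: this shifts the exponential
    rate by exactly f(u0). *)

Require Import Defs.
From mathcomp Require Import all_boot all_order all_algebra.
From mathcomp Require Import all_classical all_reals all_analysis.
From mathcomp Require Import complex measurable_realfun ring lra.

Set Implicit Arguments.
Unset Strict Implicit.
Unset Printing Implicit Defensive.

Import Order.TTheory GRing.Theory Num.Theory.
Import numFieldNormedType.Exports.

Local Open Scope classical_set_scope.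
Local Open Scope ring_scope.

(** * Ordered triangularization *)

(** The constant matrix [W] intertwines the two characteristic matrices, and its nonzero determinant
    cancels in the polynomial ring. *)
Lemma char_poly_conj (F : fieldType) n (W X M : 'M[F]_n) :
  W \in unitmx -> W *m M = X *m W -> char_poly M = char_poly X.
Proof.
move=> Wu WM; rewrite /char_poly.
have WPu : \det (map_mx (@polyC F) W) != 0.
  by rewrite det_map_mx polyC_eq0 -unitfE -unitmxE.
apply: (mulfI WPu); rewrite -det_mulmx [RHS]mulrC -det_mulmx; congr (\det _).
rewrite /char_poly_mx mulmxBr mulmxBl -!map_mxM /= WM.
by congr (_ - _); rewrite mul_mx_scalar mul_scalar_mx.
Qed.

Lemma char_poly_lblock (F : fieldType) n1 n2 (a : 'M[F]_n1) (c : 'M[F]_(n2, n1))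
    (M : 'M[F]_n2) :
  char_poly (block_mx a 0 c M) = char_poly a * char_poly M.
Proof.
rewrite /char_poly /char_poly_mx map_block_mx map_mx0 scalar_mx_block.
by rewrite opp_block_mx add_block_mx oppr0 addr0 add0r det_lblock.
Qed.

(* Rescaling the eigenvector chosen first by a large factor shrinks the
   subdiagonal entries of the first column. *)
Lemma small_triangularization (C : numFieldType) n (M : 'M[C]_n)
    (mu : 'I_n -> C) (delta : C) :
    0 < delta -> char_poly M = \prod_i ('X - (mu i)%:P) ->
  exists V L : 'M[C]_n, [/\ V \in unitmx, V *m M = L *m V,
    forall i j : 'I_n, (i < j)%N -> L i j = 0, forall i, L i i = mu i &
    forall i j : 'I_n, (j < i)%N -> `|L i j| <= delta].
Proof.
move=> delta0; elim: n M mu => [|n IHn] M mu charM.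
  exists 1%:M, 0; split=> [||[]//|[]//|[]//]; first exact: unitmx1.
  by rewrite mul0mx; apply/matrixP => -[].
have eigM : eigenvalue M (mu ord0).
  rewrite eigenvalue_root_char charM big_ord_recl rootM.
  by rewrite root_XsubC eqxx.
have [v vM vn0] := eigenvalueP eigM.
have [W [Wu W0]] : exists W : 'M[C]_n.+1,
    W \in unitmx /\ row ord0 W *m M = mu ord0 *: row ord0 W.
  (* [row_ebase] completes the rank-one row [v] to an invertible matrix whose first row is a
     multiple of [v], hence again a left eigenvector. *)
  exists (row_ebase v); split; first exact: row_ebase_unit.
  have rv : \rank v = 1%N by rewrite rank_rV vn0.
  have := mulmx_ebase v; rewrite rv [col_ebase v]mx11_scalar.
  rewrite mul_scalar_mx -scalemxAl; set k := col_ebase v 0 0.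
  have -> : pid_mx 1 *m row_ebase v = row ord0 (row_ebase v).
    rewrite rowE; congr (_ *m _); apply/matrixP => i j.
    by rewrite !mxE !ord1 eqxx /= -!val_eqE /= andbT eq_sym.
  move=> vE; have kn0 : k != 0.
    by apply: contraNneq vn0 => k0; rewrite -vE k0 scale0r.
  have -> : row ord0 (row_ebase v) = k^-1 *: v.
    by rewrite -[in RHS]vE scalerA mulVf // scale1r.
  by rewrite -scalemxAl vM !scalerA mulrC.
(* In the new basis the first row is [mu ord0] times the first unit row: the matrix is block lower
   triangular, and the other diagonal block carries the remaining eigenvalues in their given
   order. *)
pose X := W *m M *m invmx W.
have WM : W *m M = X *m W by rewrite mulmxKV.
have X0 : row ord0 X = mu ord0 *: delta_mx 0 ord0.
  by rewrite /X !row_mul W0 -scalemxAl -row_mul mulmxV // row1.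
clearbody X.
pose c : 'M[C]_(n, 1) := dlsubmx (X : 'M[C]_(1 + n)).
pose M' : 'M[C]_n := drsubmx (X : 'M[C]_(1 + n)).
have XE : X = block_mx (mu ord0)%:M 0 c M' :> 'M[C]_(1 + n).
  rewrite -[LHS](@submxK _ 1 n 1 n); congr block_mx.
    apply/matrixP => i j; rewrite !ord1 !mxE eqxx mulr1n.
    have := congr1 (fun Y : 'rV_n.+1 => Y 0 ord0) X0.
    rewrite !mxE !eqxx /= mulr1 => <-.
    by congr (X _ _); apply: val_inj.
  apply/matrixP => i j; rewrite !ord1 !mxE.
  have := congr1 (fun Y : 'rV_n.+1 => Y 0 (rshift 1 j)) X0.
  rewrite !mxE (_ : (rshift 1 j == ord0) = false) // andbF mulr0 => <-.
  by congr (X _ _); apply: val_inj.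
clearbody c M'.
have charM' : char_poly M' = \prod_(i < n) ('X - (mu (lift ord0 i))%:P).
  have : char_poly M = char_poly ((mu ord0)%:M : 'M[C]_1) * char_poly M'.
    rewrite (char_poly_conj Wu WM) XE.
    exact: (@char_poly_lblock C 1 n (mu ord0)%:M c M').
  rewrite charM big_ord_recl.
  have -> : char_poly ((mu ord0)%:M : 'M[C]_1) = 'X - (mu ord0)%:P.
    by rewrite /char_poly /char_poly_mx det_mx11 !mxE eqxx mulr1n.
  by move/mulfI => -> //; rewrite polyXsubC_eq0.
have [V' [L' [Vu VM L0 Ld Ls]]] := IHn M' _ charM'.
pose b := V' *m c.
(* Dividing by [K] brings every entry of [b] down to at most [delta]; the summand 1 keeps [K]
   positive when [b] vanishes. *)
pose K := 1 + \sum_i `|b i 0| / delta.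
have K1 : 1 <= K.
  by rewrite lerDl sumr_ge0 // => i _; rewrite divr_ge0 // ltW.
have K0 : 0 < K by rewrite (lt_le_trans ltr01).
pose Y : 'M[C]_(1 + n) := block_mx K%:M 0 0 V'.
pose L : 'M[C]_(1 + n) := block_mx (mu ord0)%:M 0 (K^-1 *: b) L'.
have Yu : Y \in unitmx.
  rewrite unitmxE det_ublock unitrM -!unitmxE Vu andbT unitmxE det_scalar1.
  by rewrite unitfE gt_eqF.
have YX : Y *m block_mx (mu ord0)%:M 0 c M' = L *m Y.
  rewrite !mulmx_block !mul0mx !mulmx0 !addr0 !add0r VM; congr block_mx.
    by rewrite -!scalar_mxM mulrC.
  by rewrite mul_mx_scalar scalerA divff ?scale1r // gt_eqF.
have L0' (i j : 'I_(1 + n)) : (i < j)%N -> L i j = 0.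
  rewrite -(fintype.splitK i) -(fintype.splitK j).
  case: (fintype.split _) => j'; case: (fintype.split _) => i' /=;
    rewrite ?ord1 //.
    by rewrite block_mxEur mxE.
  by rewrite block_mxEdr ltn_add2l; apply: L0.
have Ld' (i : 'I_(1 + n)) : L i i = mu i.
  rewrite -(fintype.splitK i); case: (fintype.split _) => i' /=.
    by rewrite block_mxEul !ord1 mxE eqxx mulr1n; congr mu; apply: val_inj.
  by rewrite block_mxEdr Ld; congr mu; apply: val_inj.
have Ls' (i j : 'I_(1 + n)) : (j < i)%N -> `|L i j| <= delta.
  rewrite -(fintype.splitK i) -(fintype.splitK j).
  case: (fintype.split _) => j'; case: (fintype.split _) => i' /=;
    rewrite ?ord1 //.
    move=> _; rewrite block_mxEdl mxE normrM normfV (gtr0_norm K0).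
    rewrite mulrC ler_pdivrMr // mulrC -ler_pdivrMr // /K.
    rewrite (bigD1 i') //= addrCA lerDl addr_ge0 // sumr_ge0 // => k _.
    by rewrite divr_ge0 // ltW.
  by rewrite block_mxEdr ltn_add2l; apply: Ls.
exists (Y *m W), L; split=> //.
  by rewrite unitmx_mul Yu.
by rewrite -mulmxA WM mulmxA XE !mulmxA; congr (_ *m _); exact: YX.
Qed.

(** * The matrix exponential *)

Section MatrixExponential.
Context {R : realType}.

Lemma cvg_mxP (m n : nat) (u : nat -> 'M[R]_(m, n)) (l : 'M[R]_(m, n)) :
  (forall i j, u k i j @[k --> \oo] --> l i j) -> u @ \oo --> l.
Proof.
move=> ul; apply/cvg_mx_entourageP => E entE.
apply: (@filter_forall _ _ _ (u @ \oo) _) => i.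
apply: (@filter_forall _ _ _ (u @ \oo) _) => j.
have /cvg_app_entourageP/(_ E entE) := ul i j.
by apply: filterS => k /mem_set.
Qed.

Lemma cvg_mx_entry (m n : nat) (u : nat -> 'M[R]_(m, n)) (l : 'M[R]_(m, n)) :
  u @ \oo --> l -> forall i j, u k i j @[k --> \oo] --> l i j.
Proof.
move=> ul i j; apply/cvg_app_entourageP => E entE.
have uE : \forall k \near \oo, forall i j, (l i j, u k i j) \in E.
  exact: ((@cvg_mx_entourageP _ _ _ (u @ \oo) _ l).1 ul E entE).
by apply: filterS uE => k /(_ i j)/set_mem.
Qed.

Lemma is_derive_sum_ord (n : nat) (h : 'I_n -> R -> R) (dh : 'I_n -> R)
    (t : R) :
  (forall i, is_derive t (1 : R) (h i) (dh i)) ->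
  is_derive t (1 : R) (fun s => \sum_i h i s) (\sum_i dh i).
Proof.
move=> hd; have -> : (fun s => \sum_i h i s) = \sum_i h i.
  by apply/funext => s; rewrite fct_sumE.
exact: is_derive_sum.
Qed.

Lemma is_derive_mul (f g : R -> R) (df dg t : R) :
  is_derive t (1 : R) f df -> is_derive t (1 : R) g dg ->
  is_derive t (1 : R) (fun s => f s * g s) (df * g t + f t * dg).
Proof.
move=> fd gd; have := is_deriveM fd gd.
by rewrite addrC [g t *: df]mulrC.
Qed.

Lemma is_derive_reflect (f : R -> R) (df a t : R) :
  is_derive (a - t) (1 : R) f df ->
  is_derive t (1 : R) (fun s => f (a - s)) (- df).
Proof.
move=> fd; rewrite -mulrN1.
apply: (@is_derive1_comp R f (fun s => a - s)) => //.
have := is_deriveB (is_derive_cst a t (1 : R)) (is_derive_id t (1 : R)).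
by rewrite sub0r.
Qed.

Variables (n : nat) (A : 'M[R]_n).
Implicit Types (t : R) (B P : 'M[R]_n).

(** The entrywise l1 norm: it bounds powers of [A] geometrically, so a scalar exponential series
    dominates the matrix series. *)
Let mx1 B : R := \sum_i \sum_j `|B i j|.

Let row_le_mx1 B i : \sum_j `|B i j| <= mx1 B.
Proof.
rewrite [leRHS](bigD1 i) //= lerDl.
by apply: sumr_ge0 => k _; apply: sumr_ge0.
Qed.

Let le_mx1 B i j : `|B i j| <= mx1 B.
Proof.
apply: le_trans (row_le_mx1 B i).
by rewrite [leRHS](bigD1 j) //= lerDl; apply: sumr_ge0.
Qed.

Let mx1_ge0 B : 0 <= mx1 B.
Proof. by apply: sumr_ge0 => i _; apply: sumr_ge0. Qed.

Let norm_mul_exp P k i j : `|(A ^+ k *m P) i j| <= mx1 A ^+ k * mx1 P.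
Proof.
elim: k i => [|k IHk] i; first by rewrite expr0 mul1mx mul1r.
rewrite exprS -mulmxE -mulmxA mxE.
apply: le_trans (ler_norm_sum _ _ _) _.
apply: (@le_trans _ _ (\sum_l `|A i l| * (mx1 A ^+ k * mx1 P))).
  by apply: ler_sum => l _; rewrite normrM ler_wpM2l.
rewrite -mulr_suml exprS -mulrA ler_wpM2r // mulr_ge0 ?exprn_ge0 //.
Qed.

(** Coefficients of the entry [(i, j)] of e^{tA} P as a power series in t. Carrying the factor [P]
    closes the family under differentiation, which turns [P] into [A *m P]. *)
Let coef P i j k : R := (A ^+ k *m P) i j / k`!%:R.

Let cvg_coef P i j t : cvgn (pseries (coef P i j) t).
Proof.
apply: normed_cvg.
have := is_cvg_series_exp_coeff (mx1 A * `|t|).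
move=> /(@is_cvg_seriesZ _ _ (mx1 P)); apply: series_le_cvg => k.
- exact: normr_ge0.
- by apply: mulr_ge0 => //; rewrite exp_coeff_ge0 // mulr_ge0.
have -> : (mx1 P *: exp_coeff (mx1 A * `|t|)) k =
    mx1 A ^+ k * mx1 P / k`!%:R * `|t| ^+ k.
  rewrite -[LHS]/(mx1 P * ((mx1 A * `|t|) ^+ k / k`!%:R)) exprMn; ring.
rewrite /= /coef !normrM normfV normrX (ger0_norm (ler0n _ _)).
by rewrite ler_wpM2r ?exprn_ge0 // ler_wpM2r ?invr_ge0 // norm_mul_exp.
Qed.

Let diffs_coef P i j : pseries_diffs (coef P i j) = coef (A *m P) i j.
Proof.
apply/funext => k; rewrite /pseries_diffs /coef mulrCA factS natrM invfM.
rewrite mulVKf // exprSr; congr (_ / _).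
by rewrite -mulmxE mulmxA.
Qed.

Let exprZmx t k : (t *: A) ^+ k = t ^+ k *: A ^+ k.
Proof.
elim: k => [|k IHk]; first by rewrite !expr0 scale1r.
by rewrite !exprS IHk -!mulmxE -scalemxAl -scalemxAr scalerA.
Qed.

Let cvg_expmx t :
  series (fun k => (k`!%:R)^-1 *: (t *: A) ^+ k) @ \oo --> expmx (t *: A).
Proof.
pose l := \matrix_(i, j) limn (pseries (coef 1%:M i j) t).
suff ul : series (fun k => (k`!%:R)^-1 *: (t *: A) ^+ k) @ \oo --> l.
  by rewrite /expmx (cvg_lim _ ul).
apply: cvg_mxP => i j; rewrite mxE.
rewrite (_ : (fun k => _) = pseries (coef 1%:M i j) t); first exact: cvg_coef.
apply/funext => k; rewrite /pseries /series /= summxE; apply: eq_bigr => q _.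
by rewrite /coef mulmx1 exprZmx !mxE; ring.
Qed.

Let cvg_expmxM P i j t :
  pseries (coef P i j) t @ \oo --> (expmx (t *: A) *m P) i j.
Proof.
rewrite mxE.
pose u := series (fun k => (k`!%:R)^-1 *: (t *: A) ^+ k).
have -> : pseries (coef P i j) t = fun k => \sum_l u k i l * P l j.
  apply/funext => k; rewrite /pseries /u /series /=.
  under [RHS]eq_bigr do rewrite summxE mulr_suml.
  rewrite exchange_big /=; apply: eq_bigr => q _.
  rewrite /coef mxE !mulr_suml; apply: eq_bigr => l _.
  by rewrite exprZmx !mxE; ring.
apply: cvg_big => [|l _]; first exact: add_continuous.
apply: cvgM; last exact: cvg_cst.
exact: (@cvg_mx_entry _ _ u _ (@cvg_expmx t)).
Qed.

Lemma expmx0 : expmx (0 *: A) = 1%:M.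
Proof.
apply/matrixP => i j; have := @cvg_expmxM 1%:M i j 0; rewrite mulmx1.
move/(cvg_lim (@Rhausdorff R)) => <-; apply: cvg_lim => //.
apply: (@cvg_near_cst _ _ _ _ _ _ _); exists 1%N => // k /= k0.
rewrite /pseries /series /= big_mkord -(prednK k0) big_ord_recl.
rewrite /coef expr0 mulmx1 /= expr0 fact0 divr1 mulr1 big1 ?addr0 // => q _.
by rewrite expr0n mulr0.
Qed.

Lemma is_derive_expmxM P i j t :
  is_derive t (1 : R) (fun s => (expmx (s *: A) *m P) i j)
    ((expmx (t *: A) *m (A *m P)) i j).
Proof.
have E Q i' j' s : (expmx (s *: A) *m Q) i' j' =
    limn (pseries (coef Q i' j') s).
  by rewrite -(cvg_lim (@Rhausdorff R) (@cvg_expmxM Q i' j' s)).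
under eq_fun do rewrite E.
rewrite E -diffs_coef.
(* Termwise differentiation at t asks for convergence at a point of larger modulus, here |t| + 1. *)
apply: (@pseries_snd_diffs _ _ (`|t| + 1)); rewrite ?diffs_coef //.
by rewrite [ltRHS]ger0_norm ?addr_ge0 // ltrDl.
Qed.

(** [A] commutes with its powers, so both sides are limits of the same partial sums. *)
Lemma expmx_comm t : A *m expmx (t *: A) = expmx (t *: A) *m A.
Proof.
apply/matrixP => i j; rewrite -(cvg_lim (@Rhausdorff R) (@cvg_expmxM A i j t)).
rewrite [LHS]mxE; apply/esym/cvg_lim => //.
have -> : pseries (coef A i j) t =
    fun k => \sum_l A i l * pseries (coef 1%:M l j) t k.
  apply/funext => k; rewrite /pseries /series /=.
  under [RHS]eq_bigr do rewrite mulr_sumr.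
  rewrite exchange_big /=; apply: eq_bigr => q _.
  rewrite /coef mulmxE -exprSr exprS -mulmxE mxE !mulr_suml.
  by apply: eq_bigr => l _; rewrite mulmx1; ring.
apply: cvg_big => [|l _]; first exact: add_continuous.
apply: cvgM; first exact: cvg_cst.
by rewrite -[expmx _]mulmx1; exact: cvg_expmxM.
Qed.

Lemma is_derive_expmx i j t :
  is_derive t (1 : R) (fun s => expmx (s *: A) i j)
    ((A *m expmx (t *: A)) i j).
Proof.
have := is_derive_expmxM 1%:M i j t.
by under eq_fun do rewrite mulmx1; rewrite mulmx1 expmx_comm.
Qed.

(** The product e^{(s+t-r)A} e^{rA} has zero derivative in r, because [A] commutes with its
    exponential; its values at r = t and r = 0 are the two sides. *)
Lemma expmxD s t :
  expmx ((s + t) *: A) = expmx (s *: A) *m expmx (t *: A).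
Proof.
apply/matrixP => i j.
pose g (r : R) := \sum_l expmx ((s + t - r) *: A) i l * expmx (r *: A) l j.
have gd (r : R) : is_derive r (1 : R) g 0.
  have E1 l := is_derive_reflect (@is_derive_expmx i l (s + t - r)).
  have := is_derive_sum_ord (fun l =>
    is_derive_mul (E1 l) (is_derive_expmx l j r)).
  congr (is_derive _ _ _ _); rewrite big_split /=.
  have -> : \sum_l expmx ((s + t - r) *: A) i l * (A *m expmx (r *: A)) l j =
      (expmx ((s + t - r) *: A) *m A *m expmx (r *: A)) i j.
    by rewrite -mulmxA [RHS]mxE.
  rewrite -expmx_comm mxE -big_split /= big1 // => l _.
  by rewrite mulNr addNr.
have := is_derive_0_is_cst t 0 gd; rewrite /g addrK mxE => ->.
rewrite subr0 expmx0 (bigD1 j) //= big1 ?addr0 => [|l lj].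
  by rewrite mxE eqxx mulr1.
by rewrite mxE (negbTE lj) mulr0.
Qed.

End MatrixExponential.

(** * Growth of the triangular flow *)

Section ComplexDerivative.
Context {R : realType}.
Implicit Types (F : R -> R[i]) (z : R[i]) (t : R).

(** The product of g(t) and e^{-ct} has nonpositive derivative for t >= 0. *)
Lemma gronwall_le (g dg : R -> R) (c : R) :
  (forall t, is_derive t (1 : R) g (dg t)) ->
  (forall t, 0 <= t -> dg t <= c * g t) ->
  forall t, 0 <= t -> g t <= expR (c * t) * g 0.
Proof.
move=> gd dgc t t0.
pose h s := g s * expR (- c * s).
have hd s : is_derive s (1 : R) h ((dg s - c * g s) * expR (- c * s)).
  have ed : is_derive s (1 : R) (fun r => expR (- c * r))
      (expR (- c * s) * - c).
    apply: (@is_derive1_comp R expR (fun r => - c * r)).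
    have := is_deriveZ (- c) (is_derive_id s (1 : R)).
    by rewrite [_ *: 1]mulr1.
  have := is_derive_mul (gd s) ed; congr (is_derive _ _ _ _); ring.
have hnincr : h t <= h 0.
  apply: (@ler0_derive1_nincry R h 0) => //.
  - move=> s; rewrite in_itv /= andbT => s0.
    rewrite derive1E (@derive_val _ _ _ _ _ _ _ (hd s)).
    by rewrite mulr_le0_ge0 ?expR_ge0 // subr_le0 dgc // ltW.
  - apply: derivable_within_continuous => s _.
    exact: (@ex_derive _ _ _ _ _ _ _ (hd s)).
rewrite -(ler_pM2r (expR_gt0 (- c * t))); apply: le_trans hnincr _.
by rewrite /h mulr0 expR0 mulr1 mulrAC mulNr -expRD subrr expR0 mul1r.
Qed.

Lemma gronwall_eq (g dg : R -> R) (c : R) :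
  (forall t, is_derive t (1 : R) g (dg t)) ->
  (forall t, 0 <= t -> dg t = c * g t) ->
  forall t, 0 <= t -> g t = expR (c * t) * g 0.
Proof.
move=> gd dgc t t0; apply/le_anti/andP; split.
  by apply: (gronwall_le gd _ t0) => s s0; rewrite dgc.
rewrite -lerN2 -mulrN.
apply: (gronwall_le (fun s => is_deriveN (gd s)) _ t0) => s s0.
by rewrite /= dgc // mulrN.
Qed.

Definition is_cderive F t z :=
  is_derive t (1 : R) (fun s => complex.Re (F s)) (complex.Re z) /\
  is_derive t (1 : R) (fun s => complex.Im (F s)) (complex.Im z).

(** The squared modulus as a real number; unlike the modulus, it stays differentiable where a
    differentiable curve passes through 0. *)
Definition sqnormc z : R := complex.Re z ^+ 2 + complex.Im z ^+ 2.

Lemma is_cderive_sum n (F : 'I_n -> R -> R[i]) (D : 'I_n -> R[i]) t :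
  (forall i, is_cderive (F i) t (D i)) ->
  is_cderive (fun s => \sum_i F i s) t (\sum_i D i).
Proof.
move=> FD; split.
  rewrite raddf_sum; under eq_fun do rewrite raddf_sum.
  by apply: is_derive_sum_ord => i; have [] := FD i.
rewrite raddf_sum; under eq_fun do rewrite raddf_sum.
by apply: is_derive_sum_ord => i; have [] := FD i.
Qed.

Lemma is_cderive_scale (a b : R[i]) (f : R -> R) (df t : R) :
  is_derive t (1 : R) f df ->
  is_cderive (fun s => a * (f s)%:C%C * b) t (a * df%:C%C * b).
Proof.
move=> fd.
have H (c : R) : is_derive t (1 : R) (fun s => c * f s) (c * df).
  exact: (is_deriveZ c fd).
have E (x : R) : a * x%:C%C * b =
    (complex.Re (a * b) * x +i* (complex.Im (a * b) * x))%C.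
  by rewrite mulrAC; case: (a * b) => p q; simpc.
split.
  by rewrite E; under eq_fun do rewrite E; exact: H.
by rewrite E; under eq_fun do rewrite E; exact: H.
Qed.

Lemma is_derive_sqnormc F t z : is_cderive F t z ->
  is_derive t (1 : R) (fun s => sqnormc (F s))
    (2 * complex.Re ((F t)^*%C * z)).
Proof.
move=> [F1 F2].
have := is_deriveD (is_derive_mul F1 F1) (is_derive_mul F2 F2).
rewrite (_ : (fun s => sqnormc (F s)) =
    (fun s => complex.Re (F s) * complex.Re (F s)) \+
    (fun s => complex.Im (F s) * complex.Im (F s))).
  congr (is_derive _ _ _ _); case: (F t) z {F1 F2} => [a b] [c e] /=; ring.
by apply/funext => s; rewrite /sqnormc !expr2.
Qed.

End ComplexDerivative.

Lemma sqnormc_ge0 {R : realType} (z : R[i]) : 0 <= sqnormc z.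
Proof. by rewrite addr_ge0 ?sqr_ge0. Qed.

Lemma sqnormcM {R : realType} (z w : R[i]) :
  sqnormc (z * w) = sqnormc z * sqnormc w.
Proof. by rewrite /sqnormc; case: z w => [a b] [c e] /=; ring. Qed.

Lemma sqnormc_eq0 {R : realType} (z : R[i]) : (sqnormc z == 0) = (z == 0).
Proof.
by rewrite paddr_eq0 ?sqr_ge0 // !sqrf_eq0 eq_complex.
Qed.

(** AM-GM with w = l b: the gap between delta |a|^2 + |w|^2 / delta and the left-hand side is |delta
    a - w|^2 / delta, and |w|^2 / delta is at most delta |b|^2. *)
Lemma Re_conj_mul_le {R : realType} (a l b : R[i]) (delta : R) :
  0 < delta -> sqnormc l <= delta ^+ 2 ->
  2 * complex.Re (a^*%C * (l * b)) <= delta * (sqnormc a + sqnormc b).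
Proof.
move=> delta0 ldelta.
have wb : sqnormc (l * b) / delta <= delta * sqnormc b.
  rewrite ler_pdivrMr // mulrAC -expr2 sqnormcM.
  by rewrite ler_wpM2r ?sqnormc_ge0.
rewrite mulrDr; apply: le_trans (lerD (lexx _) wb).
move: (l * b) => w; rewrite -subr_ge0.
rewrite (_ : _ - _ = ((delta * complex.Re a - complex.Re w) ^+ 2 +
    (delta * complex.Im a - complex.Im w) ^+ 2) / delta).
  by rewrite divr_ge0 ?addr_ge0 ?sqr_ge0 // ltW.
rewrite /sqnormc; case: a w => [a b'] [x y] /=; field.
by rewrite gt_eqF.
Qed.

(** * The flow in triangular coordinates *)

Section TriangularFlow.
Context {R : realType} {d : nat}.
Variables (A : 'M[R]_d) (V L : 'M[R[i]]_d) (mu : 'I_d -> R[i]).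
Hypotheses (Vu : V \in unitmx)
  (VL : V *m map_mx (real_complex R) A = L *m V)
  (Ltri : forall i j : 'I_d, (i < j)%N -> L i j = 0)
  (Ldiag : forall i, L i i = mu i).

(** Since V A = L V, this is e^{tL} expressed through the real exponential; it solves N' = L N with
    N(0) = 1. *)
Definition triangular_flow (t : R) : 'M[R[i]]_d :=
  V *m map_mx (real_complex R) (expmx (t *: A)) *m invmx V.
Local Notation N := triangular_flow.

Lemma triangular_flow_0 : N 0 = 1%:M.
Proof. by rewrite /N expmx0 map_mx1 mulmx1 mulmxV. Qed.

Let conjE (X : 'M[R]_d) i j :
  (V *m map_mx (real_complex R) X *m invmx V) i j =
  \sum_b \sum_a V i a * (X a b)%:C%C * invmx V b j.
Proof.
rewrite mxE; apply: eq_bigr => b _; rewrite mxE mulr_suml.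
by apply: eq_bigr => a _; rewrite !mxE.
Qed.

Lemma is_cderive_triangular_flow i j t :
  is_cderive (fun s => N s i j) t ((L *m N t) i j).
Proof.
have -> : L *m N t =
    V *m map_mx (real_complex R) (A *m expmx (t *: A)) *m invmx V.
  by rewrite map_mxM /N !mulmxA VL.
rewrite conjE; under eq_fun do rewrite /N conjE.
apply: is_cderive_sum => b; apply: is_cderive_sum => a.
exact: is_cderive_scale (is_derive_expmx A a b t).
Qed.

(** If column [j] vanishes above row [i], then, [L] being lower triangular, row [i] of N' = L N
    reduces to a scalar equation with coefficient [mu i]. *)
Let triangular_flow_entry t (i j : 'I_d) : 0 <= t ->
    (forall s (k : 'I_d), (k < i)%N -> 0 <= s -> N s k j = 0) ->
  sqnormc (N t i j) = expR (2 * complex.Re (mu i) * t) * sqnormc (N 0 i j).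
Proof.
move=> t0 Nk0.
apply: (gronwall_eq (fun s =>
  is_derive_sqnormc (is_cderive_triangular_flow i j s)) _ t0) => s s0.
rewrite [(L *m _) i j]mxE (bigD1 i) //= big1 ?addr0 => [|k ki].
  rewrite Ldiag /sqnormc; case: (N s i j) (mu i) => [a b] [x y] /=; ring.
have [ik|ik] := ltnP i k; first by rewrite Ltri // mul0r.
by rewrite Nk0 ?mulr0 // ltn_neqAle ki.
Qed.

(** Strong induction on the row: once the rows above vanish, the squared modulus is a multiple of
    its initial value, which is 0 off the diagonal. *)
Lemma triangular_flow_tri t (i j : 'I_d) : 0 <= t -> (i < j)%N -> N t i j = 0.
Proof.
have [n] := ubnP i; elim: n i t => // n IHn i t /ltnSE-le_in t0 ij.
apply/eqP; rewrite -sqnormc_eq0 (triangular_flow_entry t0) => [|s k ki s0].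
  rewrite triangular_flow_0 mxE -val_eqE ltn_eqF //=.
  by rewrite /sqnormc !expr0n addr0 mulr0.
by apply: IHn => //; [exact: leq_trans ki le_in|exact: ltn_trans ki ij].
Qed.

Lemma triangular_flow_diag t (i : 'I_d) : 0 <= t ->
  sqnormc (N t i i) = expR (2 * complex.Re (mu i) * t).
Proof.
move=> t0; rewrite (triangular_flow_entry t0) => [|s k ki s0].
  by rewrite triangular_flow_0 mxE eqxx /sqnormc /= expr1n expr0n addr0 mulr1.
exact: triangular_flow_tri.
Qed.

(* The energy of a column only involves eigenvalues of smaller real part; the
   off-diagonal terms contribute [delta] each by AM-GM. *)
Lemma triangular_flow_col (delta : R) t (j : 'I_d) : 0 < delta ->
    (forall i k : 'I_d, (k < i)%N -> sqnormc (L i k) <= delta ^+ 2) ->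
    (forall i k : 'I_d, (k <= i)%N -> complex.Re (mu i) <= complex.Re (mu k)) ->
  0 <= t ->
  \sum_i sqnormc (N t i j) <=
    expR (2 * (complex.Re (mu j) + d%:R * delta) * t).
Proof.
move=> delta0 Lsmall mu_sorted t0.
have E0 : \sum_i sqnormc (N 0 i j) = 1.
  rewrite (bigD1 j) //= big1 ?addr0 => [|i ij].
    by rewrite triangular_flow_0 mxE eqxx /sqnormc /= expr1n expr0n addr0.
  by rewrite triangular_flow_0 mxE (negbTE ij) /sqnormc /= !expr0n addr0.
rewrite -[leRHS]mulr1 -[X in _ <= _ * X]E0.
apply: (gronwall_le (fun s => is_derive_sum_ord (fun i =>
  is_derive_sqnormc (is_cderive_triangular_flow i j s))) _ t0) => s s0 /=.
set E := (X in _ <= _ * X).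
(* The bound is spread over the rows: summed over all pairs (i, k), the [delta] terms give exactly 2
   d delta E, so the comparison can be made row by row. *)
have EE : 2 * (complex.Re (mu j) + d%:R * delta) * E =
  \sum_(i < d) (2 * complex.Re (mu j) * sqnormc (N s i j) +
     \sum_(k < d) delta * (sqnormc (N s i j) + sqnormc (N s k j))).
  rewrite big_split /= -mulr_sumr -/E.
  under [X in _ = _ + X]eq_bigr do
    rewrite -mulr_sumr big_split /= -/E sumr_const card_ord.
  rewrite -mulr_sumr big_split /= sumr_const card_ord sumrMnl -/E.
  by rewrite -[E *+ d]mulr_natl; ring.
have nonneg (x y : R[i]) : 0 <= delta * (sqnormc x + sqnormc y).
  by apply: mulr_ge0; [exact: ltW|rewrite addr_ge0 ?sqnormc_ge0].
rewrite EE; apply: ler_sum => i _.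
rewrite [(L *m _) i j]mxE mulr_sumr raddf_sum /= mulr_sumr (bigD1 i) //=.
rewrite [X in _ <= _ + X](bigD1 i) //= lerD //; last first.
  apply: ler_wpDl; first exact: nonneg.
  apply: ler_sum => k ki.
  have [ik|ik] := ltnP i k.
    rewrite Ltri // mul0r mulr0 /= mulr0; exact: nonneg.
  apply: Re_conj_mul_le => //; apply: Lsmall.
  by rewrite ltn_neqAle ki.
(* Rows above [j] vanish; for the others the sorting gives Re mu_i <= Re mu_j. *)
rewrite Ldiag; have [ij|ij] := ltnP i j.
  rewrite triangular_flow_tri // mulr0 mulr0 /= /sqnormc /=.
  by rewrite !expr0n addr0 !mulr0.
rewrite [leLHS](_ : _ = 2 * complex.Re (mu i) * sqnormc (N s i j)).
  by rewrite ler_wpM2r ?sqnormc_ge0 // ler_pM2l // mu_sorted.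
by rewrite /sqnormc; case: (N s i j) (mu i) => [a b] [x y] /=; ring.
Qed.

End TriangularFlow.

(** * Sorted eigenvalues and an l1 norm on the complex numbers *)

Section SchurData.
Context {R : realType}.

Definition unstable_rate {d} (A : 'M[R]_d) : R :=
  \sum_(z <- eigenvalues A) Num.max 0 (complex.Re z).

Lemma sorted_eigenvalues d (A : 'M[R]_d) : exists mu : 'I_d -> R[i],
  [/\ char_poly (map_mx (real_complex R) A) = \prod_i ('X - (mu i)%:P),
      forall i k : 'I_d, (k <= i)%N -> complex.Re (mu i) <= complex.Re (mu k) &
      unstable_rate A = \sum_i Num.max 0 (complex.Re (mu i))].
Proof.
pose p := char_poly (map_mx (real_complex R) A).
have pE : p = \prod_(z <- eigenvalues A) ('X - z%:P).
  rewrite /eigenvalues; case: closed_field_poly_normal => s /= sE.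
  by rewrite /p sE (monicP (char_poly_monic _)) scale1r.
pose leT (x y : R[i]) := complex.Re y <= complex.Re x.
pose s := sort leT (eigenvalues A).
have perm_s : perm_eq s (eigenvalues A) by rewrite perm_sort.
have size_s : size s = d.
  have := size_char_poly (map_mx (real_complex R) A).
  by rewrite -/p pE size_prod_XsubC => -[<-]; exact: perm_size.
have leT_trans : transitive leT by move=> y x z xy yz; exact: le_trans yz xy.
have sorted_s : sorted leT s by apply: sort_sorted => x y; exact: le_total.
exists (fun i => s`_i); split.
- rewrite -/p pE -(perm_big _ perm_s) /= (big_nth 0) big_mkord.
  by rewrite size_s.
- move=> i k ki; rewrite -/(leT s`_k s`_i).
  have [|ik|/ord_inj->] := ltngtP i k; last exact: lexx.
    by rewrite ltnNge ki.
  by apply: (sorted_ltn_nth leT_trans) => //; rewrite inE size_s.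
- rewrite /unstable_rate -(perm_big _ perm_s) /= (big_nth 0) big_mkord.
  by rewrite size_s.
Qed.

(** An l1 norm on C with real values, chosen because it splits into real and imaginary parts, each
    of which is controlled by a box in R^d. *)
Definition norm1c (z : R[i]) : R := `|complex.Re z| + `|complex.Im z|.

Lemma norm1c_ge0 z : 0 <= norm1c z. Proof. by rewrite addr_ge0. Qed.

Lemma Re_le_norm1c z : `|complex.Re z| <= norm1c z.
Proof. by rewrite lerDl. Qed.

Lemma Im_le_norm1c z : `|complex.Im z| <= norm1c z.
Proof. by rewrite lerDr. Qed.

Lemma norm1cD z w : norm1c (z + w) <= norm1c z + norm1c w.
Proof.
by case: z w => [a b] [x y]; rewrite /norm1c /= addrACA lerD // ler_normD.
Qed.

Lemma norm1c_sum I (r : seq I) (P : pred I) (F : I -> R[i]) :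
  norm1c (\sum_(i <- r | P i) F i) <= \sum_(i <- r | P i) norm1c (F i).
Proof.
elim/big_rec2: _ => [|i x z _ H]; first by rewrite /norm1c /= !normr0 addr0.
by apply: le_trans (norm1cD _ _) _; rewrite lerD2l.
Qed.

Lemma norm1cM z w : norm1c (z * w) <= norm1c z * norm1c w.
Proof.
case: z w => [a b] [x y]; rewrite /norm1c /= mulrDl !mulrDr -!normrM.
rewrite [leRHS](_ : _ = `|a * x| + `|b * y| + (`|a * y| + `|b * x|)).
  by rewrite lerD ?ler_normB ?ler_normD.
ring.
Qed.

Lemma norm1c_mulmx m n p (X : 'M[R[i]]_(m, n)) (Y : 'M[R[i]]_(n, p)) c i j :
  (forall k, norm1c (Y k j) <= c) ->
  norm1c ((X *m Y) i j) <= (\sum_k norm1c (X i k)) * c.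
Proof.
move=> Yc; rewrite mxE; apply: le_trans (norm1c_sum _ _ _) _.
rewrite mulr_suml; apply: ler_sum => k _; apply: le_trans (norm1cM _ _) _.
by rewrite ler_wpM2l ?norm1c_ge0.
Qed.

Lemma sqnormc_le z : sqnormc z <= norm1c z ^+ 2.
Proof.
rewrite /sqnormc /norm1c sqrrD !real_normK ?num_real //.
by rewrite addrAC lerDl mulrn_wge0 // mulr_ge0.
Qed.

Lemma norm1c_le z c : 0 <= c -> sqnormc z <= c ^+ 2 -> norm1c z <= 2 * c.
Proof.
move=> c0 zc; have B (x y : R) : x ^+ 2 + y ^+ 2 <= c ^+ 2 -> `|x| <= c.
  move=> xy; rewrite -(ler_pXn2r (n := 2)) ?nnegrE // real_normK ?num_real //.
  by apply: le_trans xy; rewrite lerDl sqr_ge0.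
rewrite mulr2n mulrDl mul1r lerD //; first exact: B zc.
by apply: B; rewrite addrC; exact: zc.
Qed.

Lemma map_Re_mul m n p (X : 'M[R]_(m, n)) (Z : 'M[R[i]]_(n, p)) :
  map_mx (@complex.Re R) (map_mx (real_complex R) X *m Z) =
  X *m map_mx (@complex.Re R) Z.
Proof.
apply/matrixP => i j; rewrite !mxE raddf_sum; apply: eq_bigr => k _.
by rewrite !mxE; case: (Z k j) => a b /=; rewrite mul0r subr0.
Qed.

Lemma map_Im_mul m n p (X : 'M[R]_(m, n)) (Z : 'M[R[i]]_(n, p)) :
  map_mx (@complex.Im R) (map_mx (real_complex R) X *m Z) =
  X *m map_mx (@complex.Im R) Z.
Proof.
apply/matrixP => i j; rewrite !mxE raddf_sum; apply: eq_bigr => k _.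
by rewrite !mxE; case: (Z k j) => a b /=; rewrite mul0r addr0.
Qed.

Lemma norm1c_map_mul m n p (X : 'M[R]_(m, n)) (Z : 'M[R[i]]_(n, p)) i j :
  norm1c ((map_mx (real_complex R) X *m Z) i j) =
  `|(X *m map_mx (@complex.Re R) Z) i j| +
  `|(X *m map_mx (@complex.Im R) Z) i j|.
Proof. by rewrite -map_Re_mul -map_Im_mul [in RHS]mxE [X in _ + `|X|]mxE. Qed.

(** Each complex coordinate has one index for its real and one for its imaginary part; the resulting
    square is matched with pairs of real points. *)
Lemma card_cells n (k : 'I_n -> nat) :
  #|{dffun forall i : 'I_n, ('I_(k i) * 'I_(k i))%type}| =
  ((\prod_i k i) ^ 2)%N.
Proof.
rewrite card_dep_ffun foldrE big_map big_enum /=.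
rewrite expnS expn1 -big_split /=; apply: eq_bigr => i _.
by rewrite card_prod card_ord.
Qed.

End SchurData.

(** * Counting orbits of the linear flow *)

Section Counting.
Context {R : realType}.

Definition in_box {d} (r : R) (x : 'cV[R]_d) : Prop :=
  forall i, `|x i 0| <= r.

Lemma sum_norm1c_ge m n (X : 'M[R[i]]_(m, n)) i :
  \sum_k norm1c (X i k) <= \sum_j \sum_k norm1c (X j k).
Proof.
rewrite [leRHS](bigD1 i) //= lerDl; apply: sumr_ge0 => j _.
by apply: sumr_ge0 => k _; exact: norm1c_ge0.
Qed.

Lemma natr_sqr_dist_lt1 (m n : nat) : (m%:R - n%:R : R) ^+ 2 < 1 -> m = n.
Proof.
rewrite -[_ - _]/(m%:~R - n%:~R) -intrB -rmorphXn /= -[1]/(1%:~R) ltr_int.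
apply: contraTeq => mn; rewrite -leNgt -real_normK ?num_real //.
by rewrite exprn_ege1 // -gtz0_ge1 normr_gt0 subr_eq0 eqz_nat.
Qed.

(** [X] gathers both components of all values of [F]. The index families embed into pairs over [X],
    and square roots on both sides give a count in R^d. *)
Lemma pairs_of_cells n (k : 'I_n -> nat) (T : eqType)
    (F : (forall i, 'I_(k i) * 'I_(k i)) -> T * T) :
  (forall p p', F p = F p' -> forall i, p i = p' i) ->
  exists X : seq T, [/\ uniq X, (\prod_i k i <= size X)%N &
    forall u, u \in X -> exists p, u = (F p).1 \/ u = (F p).2].
Proof.
move=> Finj.
pose G (p : {dffun forall i : 'I_n, ('I_(k i) * 'I_(k i))%type}) := F p.
have Ginj : injective G by move=> p p' /Finj pp'; exact/ffunP.
pose X := undup (map fst (codom G) ++ map snd (codom G)).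
exists X; split; first exact: undup_uniq.
  rewrite -leq_sqr -card_cells -(size_codom G) expnS expn1.
  rewrite -(size_allpairs pair).
  apply: uniq_leq_size; first by rewrite map_inj_uniq ?enum_uniq.
  move=> _ /codomP[p ->]; apply/allpairsP; exists (G p); split=> /=.
  - by rewrite mem_undup mem_cat map_f // codom_f.
  - by rewrite mem_undup mem_cat orbC map_f // codom_f.
  - exact: surjective_pairing.
move=> u; rewrite mem_undup mem_cat => /orP[] /mapP[_ /codomP[p ->] ->].
  by exists p; left.
by exists p; right.
Qed.

(** Dual counting: pairs over [E] embed into the cells, so the square of the size of [E] is at most
    the square of the product. *)
Lemma leq_size_cells n (k : 'I_n -> nat) (T : eqType) (E : seq T)
    (cell : T * T -> forall i, 'I_(k i) * 'I_(k i)) : uniq E ->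
  {in [seq (x, y) | x <- E, y <- E] &, forall p p',
    (forall i, cell p i = cell p' i) -> p = p'} ->
  (size E <= \prod_i k i)%N.
Proof.
move=> uE cell_inj.
pose G p : {dffun forall i : 'I_n, ('I_(k i) * 'I_(k i))%type} :=
  [ffun i => cell p i].
have Ginj : {in [seq (x, y) | x <- E, y <- E] &, injective G}.
  move=> p p' pE p'E /ffunP GE; apply: cell_inj => // i.
  by have := GE i; rewrite !ffunE.
rewrite -leq_sqr -card_cells expnS expn1 -(size_allpairs pair).
rewrite -(size_map G) cardT; apply: uniq_leq_size.
  by rewrite map_inj_in_uniq // allpairs_uniq // => -[? ?] [? ?] _ _.
by move=> p _; rewrite mem_enum.
Qed.

Lemma eq_grid_point (a : R) (m n m' n' : nat) : 0 < a ->
  sqnormc ((a * m%:R +i* (a * n%:R))%C - (a * m'%:R +i* (a * n'%:R))%C) <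
    a ^+ 2 -> m = m' /\ n = n'.
Proof.
move=> a0; rewrite /sqnormc /= -!mulrBr ![(a * _) ^+ 2]exprMn -mulrDr.
rewrite gtr_pMr ?exprn_gt0 // => lt1; split; apply: natr_sqr_dist_lt1.
  by apply: le_lt_trans lt1; rewrite lerDl sqr_ge0.
by apply: le_lt_trans lt1; rewrite lerDr sqr_ge0.
Qed.

(** Row [i] of the flow is zero right of the diagonal and the difference is zero before coordinate
    [i], so coordinate [i] of the image is the diagonal entry times the difference there. The added
    1 makes the bound strict, as [eq_grid_point] requires. *)
Lemma first_coordinate_separation d (A : 'M[R]_d) (V L : 'M[R[i]]_d)
    (mu : 'I_d -> R[i]) (rho tau : R) (zeta zeta' : 'cV[R[i]]_d) (i : 'I_d) :
  V \in unitmx -> V *m map_mx (real_complex R) A = L *m V ->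
  (forall i j : 'I_d, (i < j)%N -> L i j = 0) -> (forall i, L i i = mu i) ->
  0 <= tau ->
  in_box rho (expmx (tau *: A) *m
    (map_mx (@complex.Re R) (invmx V *m zeta) -
     map_mx (@complex.Re R) (invmx V *m zeta'))) ->
  in_box rho (expmx (tau *: A) *m
    (map_mx (@complex.Im R) (invmx V *m zeta) -
     map_mx (@complex.Im R) (invmx V *m zeta'))) ->
  (forall j : 'I_d, (j < i)%N -> zeta j 0 = zeta' j 0) ->
  expR (2 * complex.Re (mu i) * tau) * sqnormc (zeta i 0 - zeta' i 0) <
    ((\sum_i \sum_k norm1c (V i k)) * (2 * `|rho|) + 1) ^+ 2.
Proof.
move=> Vu VL Ltri Ldiag tau0 boxRe boxIm zetaE.
pose xi := zeta - zeta'.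
have xiE j : xi j 0 = zeta j 0 - zeta' j 0 by rewrite !mxE.
have flowE : (triangular_flow A V tau *m xi) i 0 =
    triangular_flow A V tau i i * xi i 0.
  rewrite mxE (bigD1 i) //= big1 ?addr0 // => j ji.
  have [ij|ij] := ltnP i j.
    by rewrite (triangular_flow_tri Vu VL Ltri Ldiag) // mul0r.
  by rewrite xiE zetaE ?subrr ?mulr0 // ltn_neqAle ij andbT.
rewrite -xiE -(triangular_flow_diag Vu VL Ltri Ldiag) // -sqnormcM -flowE.
have vv0 : 0 <= \sum_i \sum_k norm1c (V i k).
  by apply: sumr_ge0 => j _; apply: sumr_ge0 => k _; exact: norm1c_ge0.
apply: le_lt_trans (sqnormc_le _) _.
rewrite ltr_pXn2r ?nnegrE ?norm1c_ge0 ?addr_ge0 ?mulr_ge0 //.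
rewrite /triangular_flow -!mulmxA.
apply: (@le_lt_trans _ _ ((\sum_j norm1c (V i j)) * (2 * `|rho|))).
  apply: norm1c_mulmx => j.
  rewrite mulmxBr norm1c_map_mul !map_mxB /= mulr2n mulrDl mul1r.
  rewrite lerD //; apply: le_trans (ler_norm rho).
    exact: boxRe.
  exact: boxIm.
by rewrite ltr_pwDr // ler_wpM2r ?sum_norm1c_ge // mulr_ge0.
Qed.

(* Distinct points of a product grid whose mesh in the j-th triangular
   coordinate is proportional to exp(- tau Re mu_j) are moved apart by the
   flow: look at the first coordinate in which they differ. *)
Lemma expanding_count d (A : 'M[R]_d) (rho r : R) : 0 < r ->
  exists2 kappa : R, 0 < kappa & forall (tau : R), 0 <= tau ->
  forall (T : eqType) (g : 'cV[R]_d -> T),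
  (forall x x', in_box r x -> in_box r x' -> g x = g x' ->
     in_box rho (expmx (tau *: A) *m (x - x'))) ->
  exists X : seq T, [/\ uniq X,
    forall u, u \in X -> exists2 x, in_box r x & u = g x &
    kappa * expR (unstable_rate A * tau) <= (size X)%:R].
Proof.
move=> r0.
have [mu [charA _ ->]] := sorted_eigenvalues A.
have [V [L [Vu VL Ltri Ldiag _]]] :=
  small_triangularization (@ltr01 R[i]) charA.
clear charA.
pose vi := \sum_i \sum_k norm1c (invmx V i k).
pose vv := \sum_i \sum_k norm1c (V i k).
have sum2_ge0 (X : 'M[R[i]]_d) : 0 <= \sum_i \sum_k norm1c (X i k).
  by apply: sumr_ge0 => i _; apply: sumr_ge0 => k _; exact: norm1c_ge0.
have vi0 : 0 <= vi by exact: sum2_ge0.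
have vv0 : 0 <= vv by exact: sum2_ge0.
(* Grid coordinates in [0, rr] stay in the box of radius [r] after the passage back by [invmx V]. *)
pose rr := r / (2 * (1 + vi)).
have rr0 : 0 < rr by rewrite divr_gt0 // mulr_gt0 // ltr_wpDr.
pose rho' := vv * (2 * `|rho|) + 1.
have rho'0 : 0 < rho' by rewrite ltr_wpDl // !mulr_ge0.
(* One factor for both kinds of coordinates: an expanding one has at least [rr / a i] grid values,
   any other at least one. *)
pose q := Num.min 1 (rr / rho').
have q0 : 0 < q by rewrite lt_min ltr01 divr_gt0.
exists (q ^+ d); first exact: exprn_gt0.
move=> tau tau0 T g gsep.
(* A difference of at least this mesh in the first differing coordinate has modulus at least [rho']
   at time [tau], too much for two points with the same value of [g]. *)
pose a (i : 'I_d) := rho' * expR (- (complex.Re (mu i) * tau)).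
have a0 i : 0 < a i by rewrite mulr_gt0 // expR_gt0.
pose k (i : 'I_d) := (Num.truncn (rr / a i)).+1.
have ka i (n : 'I_(k i)) : a i * (val n)%:R <= rr.
  rewrite mulrC -ler_pdivlMr //.
  have /andP[+ _] := truncn_itv (ltW (divr_gt0 rr0 (a0 i))).
  by apply: le_trans; rewrite ler_nat -ltnS ltn_ord.
have k_gt0 i : (0 < k i)%N by [].
have k_ge i : rr / a i <= (k i)%:R by exact: ltW (truncnS_gt _).
clearbody k.
pose P := forall i, 'I_(k i) * 'I_(k i).
pose zeta (p : P) : 'cV[R[i]]_d :=
  \col_i (a i * (val (p i).1)%:R +i* (a i * (val (p i).2)%:R))%C.
pose Z p := invmx V *m zeta p.
have Zr p i : norm1c (Z p i 0) <= r.
  apply: (@le_trans _ _ ((\sum_j norm1c (invmx V i j)) * (2 * rr))).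
    apply: norm1c_mulmx => j; rewrite mxE /norm1c /= mulr2n mulrDl mul1r.
    by rewrite lerD // ger0_norm ?ka // mulr_ge0 // ltW.
  apply: (@le_trans _ _ (vi * (2 * rr))).
    by rewrite ler_wpM2r ?sum_norm1c_ge // mulr_ge0 // ltW.
  have -> : vi * (2 * rr) = r * (vi / (1 + vi)).
    by rewrite /rr; field; rewrite gt_eqF // ltr_wpDr.
  by rewrite ler_piMr ?(ltW r0) // ler_pdivrMr ?ltr_wpDr // mul1r lerDr.
pose x p := map_mx (@complex.Re R) (Z p).
pose y p := map_mx (@complex.Im R) (Z p).
have xr p : in_box r (x p).
  by move=> i; rewrite mxE; apply: le_trans (Zr p i); rewrite lerDl.
have yr p : in_box r (y p).
  by move=> i; rewrite mxE; apply: le_trans (Zr p i); rewrite lerDr.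
pose F p := (g (x p), g (y p)).
have Finj p p' : F p = F p' -> forall i, p i = p' i.
  move=> Fpp'; have gx := gsep _ _ (xr p) (xr p') (congr1 fst Fpp').
  have gy := gsep _ _ (yr p) (yr p') (congr1 snd Fpp').
  (* Strong induction on the coordinate: agreement before [i] forces agreement at [i]. *)
  suff step (i : 'I_d) :
      (forall j : 'I_d, (j < i)%N -> p j = p' j) -> p i = p' i.
    move=> i; have [n] := ubnP i; elim: n i => [//|n IHn] i lein.
    apply: step => j ji; apply: IHn; exact: leq_trans ji lein.
  move=> pE.
  have zetaE (j : 'I_d) : (j < i)%N -> zeta p j 0 = zeta p' j 0.
    by move=> ji; rewrite !mxE (pE j).
  have := first_coordinate_separation Vu VL Ltri Ldiag tau0 gx gy zetaE.
  rewrite -/vv -/rho'.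
  have -> : rho' ^+ 2 = expR (2 * complex.Re (mu i) * tau) * a i ^+ 2.
    rewrite /a exprMn mulrCA -expRM_natl -expRD -mulrA mulrN subrr.
    by rewrite expR0 mulr1.
  rewrite ltr_pM2l; last exact: expR_gt0.
  rewrite [zeta p i 0]mxE [zeta p' i 0]mxE => /(eq_grid_point (a0 i))[E1 E2].
  rewrite [LHS]surjective_pairing [RHS]surjective_pairing.
  by congr (_, _); apply: val_inj.
have [X [uX kX memX]] := pairs_of_cells Finj.
exists X; split=> // [u /memX[p [->|->]]|]; [by exists (x p)|by exists (y p)|].
apply: (@le_trans _ _ (\prod_i k i)%:R); last by rewrite ler_nat.
rewrite natr_prod mulr_suml expR_sum.
have -> : q ^+ d = \prod_(i < d) q by rewrite prodr_const card_ord.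
rewrite -big_split /=; apply: ler_prod => i _.
rewrite mulr_ge0 ?expR_ge0 ?(ltW q0) //=.
have [Re0|Re0] := ltP 0 (complex.Re (mu i)).
  apply: (@le_trans _ _ (rr / a i)); last exact: k_ge.
  rewrite /a invfM -expRN opprK mulrA ler_wpM2r ?expR_ge0 //.
  by rewrite ge_min lexx orbT.
rewrite mul0r expR0 mulr1.
by apply: (@le_trans _ _ 1); rewrite ?ge_min ?lexx ?ler1n ?k_gt0.
Qed.

Lemma dist_lt_cell (s s' l : R) (n : nat) : 0 < l ->
  0 <= s -> 0 <= s' -> s <= n%:R * l -> s' <= n%:R * l ->
  inord (Num.truncn (s / l)) = inord (Num.truncn (s' / l)) :> 'I_n.+1 ->
  `|s - s'| <= l.
Proof.
move=> l0 s0 s'0 sn s'n /(congr1 (@nat_of_ord _)).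
(* [inord] sends indices out of range to a default, so both must be shown in range before equality
   of cells says anything. *)
have bound (u : R) : 0 <= u -> u <= n%:R * l -> (Num.truncn (u / l) < n.+1)%N.
  move=> u0 un; rewrite ltnS -(ler_nat R).
  apply: le_trans (_ : u / l <= _); last by rewrite ler_pdivrMr.
  by rewrite truncn_le divr_ge0 // ltW.
rewrite !inordK ?bound // => E.
have /andP[s1 s2] := truncn_itv (divr_ge0 s0 (ltW l0)).
have /andP[] := truncn_itv (divr_ge0 s'0 (ltW l0)); rewrite -E.
move: (Num.truncn _) s1 s2 => t; rewrite -natr1.
rewrite !ler_pdivlMr // !ltr_pdivrMr // => t1 t2 t3 t4.
rewrite ler_norml; apply/andP; split; nra.
Qed.

(* Points of the same cell of a product partition of C^d, whose mesh in the
   j-th triangular coordinate is proportional to exp(- tau max(0, Re mu_j)),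
   stay close until time tau. *)
Lemma separated_count d (A : 'M[R]_d) (rho eps delta : R) :
  0 < eps -> 0 < delta ->
  exists2 C : R, 0 < C & forall (tau : R), 0 <= tau ->
  forall E : seq 'cV[R]_d, uniq E -> (forall x, x \in E -> in_box rho x) ->
  (forall x y, x \in E -> y \in E ->
    (forall t, 0 <= t <= tau -> in_box eps (expmx (t *: A) *m (x - y))) ->
    x = y) ->
  (size E)%:R <= C * expR ((unstable_rate A + delta) * tau).
Proof.
move=> eps0 delta0.
have [mu [charA mu_sorted ->]] := sorted_eigenvalues A.
(* Each of the d columns loses [d%:R * delta'] in its exponent, and d^2 delta' is at most
   [delta]. *)
pose delta' := delta / (1 + d%:R ^+ 2).
have delta'0 : 0 < delta' by rewrite divr_gt0 // ltr_wpDr // exprn_ge0.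
have delta'C0 : 0 < delta'%:C%C :> R[i] by rewrite ltcR.
have [V [L [Vu VL Ltri Ldiag Lsmall]]] :=
  small_triangularization delta'C0 charA.
clear charA.
have {}Lsmall (i k : 'I_d) : (k < i)%N -> sqnormc (L i k) <= delta' ^+ 2.
  move=> /Lsmall; rewrite normc_def lecR -/(sqnormc _) => H.
  rewrite -(sqr_sqrtr (sqnormc_ge0 (L i k))).
  by rewrite ler_pXn2r ?nnegrE ?sqrtr_ge0 // ltW.
pose vi := \sum_i \sum_k norm1c (invmx V i k).
pose vv := \sum_i \sum_k norm1c (V i k).
have sum2_ge0 (X : 'M[R[i]]_d) : 0 <= \sum_i \sum_k norm1c (X i k).
  by apply: sumr_ge0 => i _; apply: sumr_ge0 => k _; exact: norm1c_ge0.
have vi0 : 0 <= vi by exact: sum2_ge0.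
have vv0 : 0 <= vv by exact: sum2_ge0.
pose rho1 := vv * (2 * `|rho|).
have rho10 : 0 <= rho1 by rewrite !mulr_ge0.
(* Entries of size at most 4 d c in triangular coordinates become entries of size at most [eps]
   under [invmx V]. *)
pose c := eps / (4 * (1 + vi) * (1 + d%:R)).
have c0 : 0 < c by rewrite divr_gt0 // !mulr_gt0 // ltr_wpDr.
(* Chosen so that [k j], the number of cells per real direction, is at most [K * g j]; the constant
   part 2 is absorbed since [g j] is at least 1. *)
pose K := 2 * rho1 / c + 2.
have K0 : 0 < K.
  by apply: ltr_wpDl => //; apply: divr_ge0; [exact: mulr_ge0|exact: ltW].
exists (K ^+ d); first exact: exprn_gt0.
move=> tau tau0 E uE Erho Esep.
pose g (j : 'I_d) :=
  expR ((Num.max 0 (complex.Re (mu j)) + d%:R * delta') * tau).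
have max0 (x : R) : 0 <= Num.max 0 x by rewrite le_max lexx.
have g1 j : 1 <= g j.
  by rewrite /g -expR0 ler_expR mulr_ge0 // addr_ge0 // mulr_ge0 // ltW.
have g0 j : 0 < g j by exact: expR_gt0.
(* The mesh is inverse to the growth [g j] of column j up to time [tau], so mesh times growth is the
   constant [c]. *)
pose l j := c / g j.
have l0 j : 0 < l j by rewrite divr_gt0.
pose n j := Num.truncn (2 * rho1 / l j).
have n_lt j : 2 * rho1 / l j < (n j).+1%:R by exact: truncnS_gt.
have n_le j : (n j)%:R <= 2 * rho1 / l j.
  by rewrite truncn_le; apply: divr_ge0; [exact: mulr_ge0|exact: ltW].
clearbody n.
pose k (j : 'I_d) := (n j).+1.+1.
pose cplx (xy : 'cV[R]_d * 'cV[R]_d) : 'cV[R[i]]_d :=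
  \col_i (xy.1 i 0 +i* xy.2 i 0)%C.
have [idx idx_close] : exists idx : forall j, R -> 'I_(k j),
    forall j s s', `|s| <= rho1 -> `|s'| <= rho1 -> idx j s = idx j s' ->
    `|s - s'| <= l j.
  (* The shift by [rho1] makes the coordinates nonnegative before truncation. *)
  exists (fun j s => inord (Num.truncn ((s + rho1) / l j))).
  move=> j s s' sb s'b ss'.
  have /andP[s1 s2] : - rho1 <= s <= rho1 by rewrite -ler_norml.
  have /andP[s3 s4] : - rho1 <= s' <= rho1 by rewrite -ler_norml.
  have -> : s - s' = s + rho1 - (s' + rho1) by ring.
  have bound u : u <= rho1 -> u + rho1 <= (n j).+1%:R * l j.
    move=> u1; apply: (@le_trans _ _ (2 * rho1)); first lra.
    by rewrite -ler_pdivrMr // ltW.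
  apply: (dist_lt_cell (l0 j) _ _ _ _ ss').
  - by rewrite -lerBlDr sub0r.
  - by rewrite -lerBlDr sub0r.
  - exact: bound.
  - exact: bound.
pose cell (xy : 'cV[R]_d * 'cV[R]_d) j : 'I_(k j) * 'I_(k j) :=
  (idx j (complex.Re ((V *m cplx xy) j 0)),
   idx j (complex.Im ((V *m cplx xy) j 0))).
have cell_inj : {in [seq (x, y) | x <- E, y <- E] &, forall p p',
    (forall j, cell p j = cell p' j) -> p = p'}.
  move=> xy xy' /allpairsP[[x y] [/= xE yE ->]].
  move=> /allpairsP[[x' y'] [/= x'E y'E ->]].
  move=> cellE.
  pose xi := V *m (cplx (x, y) - cplx (x', y')).
  have zeta_bound u v j : u \in E -> v \in E ->
      norm1c ((V *m cplx (u, v)) j 0) <= rho1.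
    move=> uE' vE'.
    apply: (@le_trans _ _ ((\sum_i norm1c (V j i)) * (2 * `|rho|))).
      apply: norm1c_mulmx => i; rewrite mxE /norm1c /= mulr2n mulrDl mul1r.
      by rewrite lerD // (le_trans _ (ler_norm rho)) //; exact: Erho.
    by rewrite ler_wpM2r ?sum_norm1c_ge // mulr_ge0.
  have xi_small j : norm1c (xi j 0) <= 2 * l j.
    have [E1 E2] := cellE j.
    have -> : xi j 0 = (V *m cplx (x, y)) j 0 - (V *m cplx (x', y')) j 0.
      by rewrite /xi mulmxBr [LHS]mxE [X in _ + X]mxE.
    rewrite /norm1c !raddfB mulr2n mulrDl mul1r; apply: lerD.
      apply: idx_close E1.
        by apply: le_trans (zeta_bound x y j xE yE); exact: Re_le_norm1c.
      by apply: le_trans (zeta_bound x' y' j x'E y'E); exact: Re_le_norm1c.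
    apply: idx_close E2.
      by apply: le_trans (zeta_bound x y j xE yE); exact: Im_le_norm1c.
    by apply: le_trans (zeta_bound x' y' j x'E y'E); exact: Im_le_norm1c.
  have close t i : 0 <= t <= tau ->
    norm1c ((map_mx (real_complex R) (expmx (t *: A)) *m
       (cplx (x, y) - cplx (x', y'))) i 0) <= eps.
    move=> /andP[t0 ttau].
    have -> : map_mx (real_complex R) (expmx (t *: A)) *m
       (cplx (x, y) - cplx (x', y')) =
       invmx V *m (triangular_flow A V t *m xi).
      by rewrite /triangular_flow /xi !mulmxA (mulVmx Vu) mul1mx (mulmxKV Vu).
    have Nxi j : norm1c ((triangular_flow A V t *m xi) j 0) <= 4 * d%:R * c.
      rewrite mxE; apply: le_trans (norm1c_sum _ _ _) _.
      apply: (@le_trans _ _ (\sum_(j < d) 4 * c)); last first.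
        by rewrite sumr_const card_ord -mulr_natr; lra.
      apply: ler_sum => i' _; apply: le_trans (norm1cM _ _) _.
      have -> : 4 * c = 2 * g i' * (2 * l i').
        by rewrite /l; field; rewrite gt_eqF.
      apply: ler_pM; rewrite ?norm1c_ge0 //.
      apply: norm1c_le; first exact: ltW.
      have :=
        triangular_flow_col Vu VL Ltri Ldiag i' delta'0 Lsmall mu_sorted t0.
      rewrite (bigD1 j) //= => colE; apply: le_trans (le_trans _ colE) _.
        by rewrite lerDl sumr_ge0 // => *; exact: sqnormc_ge0.
      rewrite /g -expRM_natl ler_expR -mulrA ler_pM2l // .
      apply: (@le_trans _ _
        ((Num.max 0 (complex.Re (mu i')) + d%:R * delta') * t)).
        by rewrite ler_wpM2r // lerD2r le_max lexx orbT.
      by rewrite ler_wpM2l // addr_ge0 // mulr_ge0 // ltW.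
    apply: le_trans (norm1c_mulmx _ _ Nxi) _.
    apply: (@le_trans _ _ (vi * (4 * d%:R * c))).
      apply: ler_wpM2r; last exact: sum_norm1c_ge.
      by apply: mulr_ge0; [exact: mulr_ge0|exact: ltW].
    have -> : vi * (4 * d%:R * c) =
        eps * ((vi / (1 + vi)) * (d%:R / (1 + d%:R))).
      by rewrite /c; field; rewrite !gt_eqF // ltr_wpDr.
    rewrite ler_piMr ?(ltW eps0) // mulr_ile1 ?divr_ge0 ?addr_ge0 //.
      by rewrite ler_pdivrMr ?ltr_wpDr // mul1r lerDr.
    by rewrite ler_pdivrMr ?ltr_wpDr // mul1r lerDr.
  have ReE : map_mx (@complex.Re R) (cplx (x, y) - cplx (x', y')) = x - x'.
    by apply/matrixP => i j; rewrite !mxE raddfB !ord1.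
  have ImE : map_mx (@complex.Im R) (cplx (x, y) - cplx (x', y')) = y - y'.
    by apply/matrixP => i j; rewrite !mxE raddfB !ord1.
  congr (_, _).
    apply: Esep => // t tt i; have := close t i tt.
    by rewrite norm1c_map_mul ReE; apply: le_trans; rewrite lerDl.
  apply: Esep => // t tt i; have := close t i tt.
  by rewrite norm1c_map_mul ImE; apply: le_trans; rewrite lerDr.
have kE := leq_size_cells uE cell_inj.
apply: (@le_trans _ _ (\prod_j k j)%:R); first by rewrite ler_nat.
apply: (@le_trans _ _ (\prod_j (K * g j))).
  rewrite natr_prod; apply: ler_prod => j _; rewrite ler0n /=.
  have -> : (k j)%:R = (n j)%:R + 2 :> R by rewrite /k -addn2 natrD.
  have -> : K * g j = 2 * rho1 / l j + 2 * g j.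
    by rewrite /K /l; field; rewrite !gt_eqF.
  by rewrite lerD // ler_peMr.
rewrite big_split /= prodr_const card_ord ler_wpM2l ?exprn_ge0 ?(ltW K0) //.
rewrite -expR_sum ler_expR -mulr_suml ler_wpM2r // big_split /= lerD2l.
rewrite sumr_const card_ord -[leLHS]mulr_natl mulrA -expr2 /delta' mulrCA.
by rewrite ler_piMr ?(ltW delta0) // ler_pdivrMr ?ltr_wpDr // mul1r lerDr.
Qed.

End Counting.

(** * Integration against the completed Lebesgue measure *)

Section CompletedLebesgue.
Context {R : realType}.
Local Notation lambda := (@completed_lebesgue_measure R).

Lemma measurable_completed (D : set R) :
  @measurable _ (measurableTypeR R) D -> @measurable _ (lebesgueR R) D.
Proof. exact: sub_caratheodory. Qed.

Lemma measurable_completed_itv (i : interval R) :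
  @measurable _ (lebesgueR R) [set` i].
Proof. by apply: measurable_completed; exact: measurable_itv. Qed.

(** Borel sets are Lebesgue measurable; composing with this identity carries Borel measurability
    over to the completed line. *)
Lemma measurable_id_completed :
  measurable_fun [set: lebesgueR R] (idfun : lebesgueR R -> measurableTypeR R).
Proof.
by move=> _ D mD; rewrite setTI preimage_id; exact: measurable_completed.
Qed.

Lemma measurable_continuous_completed (h : R -> R) : continuous h ->
  measurable_fun [set: lebesgueR R] h.
Proof.
move=> hc; apply: (measurableT_comp _ measurable_id_completed).
exact: continuous_measurable_fun.
Qed.

Lemma completed_lebesgue_measure_itv (a b : R) : a <= b ->
  lambda `[a, b] = (b - a)%:E.
Proof.
move=> ab; rewrite -[LHS]/(lebesgue_measure `[a, b]%classic).
rewrite lebesgue_measure_itv /= lte_fin; case: ltgtP ab => // -> _.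
by rewrite subrr.
Qed.

Lemma completed_lebesgue_measure_itv_lty (a b : R) : (lambda `[a, b] < +oo)%E.
Proof.
have [ab|ba] := leP a b; last first.
  by rewrite set_itv_ge ?measure0 // bnd_simp -ltNge.
apply: (@le_lt_trans _ _ (b - a)%:E); last exact: ltry.
by rewrite -(completed_lebesgue_measure_itv ab).
Qed.

Lemma measurable_fun_le_completed (T : R) :
  measurable_fun [set: lebesgueR R] (fun t : lebesgueR R => t <= T).
Proof.
apply: (@measurable_fun_bool _ _ _ _ true).
rewrite setTI.
have -> : (fun t : R => t <= T) @^-1` [set true] = [set` `]-oo, T] ].
  by apply/seteqP; split=> t /=; rewrite in_itv.
exact: measurable_completed_itv.
Qed.

Lemma continuous_bounded_itv (h : R -> R) (a b : R) : continuous h ->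
  [bounded h x | x in `[a, b]].
Proof.
move=> hc.
have : bounded_set (h @` `[a, b]).
  apply: compact_bounded.
  apply: continuous_compact; last exact: segment_compact.
  exact: continuous_subspaceT.
rewrite /bounded_near => hB; near=> M => x xab.
have hM : globally (h @` `[a, b]) [set y | `|y| <= M] by near: M.
by apply: hM; exists x.
Unshelve. all: by end_near.
Qed.

Lemma integrable_continuous_completed (h : R -> R) (a b : R) : continuous h ->
  lambda.-integrable `[a, b] (EFin \o h).
Proof.
move=> hc; apply: measurable_bounded_integrable.
- exact: measurable_completed_itv.
- exact: completed_lebesgue_measure_itv_lty.
- by apply: measurable_funS (measurable_continuous_completed hc).
- exact: continuous_bounded_itv.
Qed.

(** Change of variables along the identity, whose image measure on Borel sets is Lebesgue
    measure. *)
Lemma integral_completed (h : R -> R) (a b : R) : continuous h ->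
  \int[lambda]_(s in `]a, b]) h s =
  \int[lebesgue_measure]_(s in `]a, b]) h s.
Proof.
move=> hc; congr fine.
have /measurable_EFinP mh := @continuous_measurable_fun R h hc.
have ih : lambda.-integrable (idfun @^-1` `]a, b]) ((EFin \o h) \o idfun).
  apply: integrableS (integrable_continuous_completed a b hc).
  - exact: measurable_completed_itv.
  - exact: measurable_completed_itv.
  - exact: subset_itv_oc_cc.
have := integral_pushforward measurable_id_completed mh ih (measurable_itv _).
rewrite (eq_measure_integral lebesgue_measure) => [->|] //.
Qed.

Lemma completed_FTC (F f : R -> R) (a b : R) : a <= b -> continuous f ->
  (forall s, is_derive s (1 : R) F (f s)) ->
  \int[lambda]_(s in `]a, b]) f s = F b - F a.
Proof.
move=> ab fc Fd; have [->|anb] := eqVneq a b.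
  by rewrite set_itvoc0 Rintegral_set0 subrr.
have altb : a < b by rewrite lt_neqAle anb.
have Fc : continuous F.
  move=> s; apply: differentiable_continuous; apply/derivable1_diffP.
  by have [] := Fd s.
rewrite integral_completed // Rintegral_itv_obnd_cbnd; last first.
  have If : lebesgue_measure.-integrable `[a, b] (EFin \o f).
    apply: continuous_compact_integrable; first exact: segment_compact.
    exact: continuous_subspaceT.
  by apply: integrableS If => //; exact: subset_itv_oc_cc.
rewrite /Rintegral (@continuous_FTC2 _ f F) //.
- exact: continuous_subspaceT.
- split.
  + by move=> s _; have [] := Fd s.
  + exact: cvg_at_right_filter (Fc a).
  + exact: cvg_at_left_filter (Fc b).
- by move=> s _; rewrite derive1E (@derive_val _ _ _ _ _ _ _ (Fd s)).
Qed.

(** A nonnegative integral is a supremum over simple functions below the integrand, hence monotone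
    without measurability. This allows estimates of the integral of [f (w t)] with no measurability
    proof. *)
Lemma ge0_le_integral_nomeas (D : set (lebesgueR R))
    (f g : lebesgueR R -> \bar R) :
  (forall t, D t -> 0 <= f t)%E -> (forall t, D t -> f t <= g t)%E ->
  (\int[lambda]_(t in D) f t <= \int[lambda]_(t in D) g t)%E.
Proof.
move=> f0 fg; rewrite !ge0_integralE // => [|t Dt].
  apply: le_ereal_sup => _ [h /= hf <-]; exists h => // t.
  apply: le_trans (hf t) _; rewrite /patch; case: ifPn => //.
  by rewrite inE => /fg.
exact: le_trans (f0 t Dt) (fg t Dt).
Qed.

(* The positive and negative parts are compared separately; boundedness
   excludes oo - oo. *)
Lemma le_Rintegral_bounded (D : set (lebesgueR R)) (f g : R -> R) (c M : R) :
  measurable D -> (lambda D < +oo)%E ->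
  (forall t, D t -> c <= f t) -> (forall t, D t -> f t <= g t) ->
  (forall t, D t -> g t <= M) ->
  \int[lambda]_(t in D) f t <= \int[lambda]_(t in D) g t.
Proof.
move=> mD Dfin cf fg gM.
pose B := `|c| + `|M|.
have bound (h : R -> R) : (forall t, D t -> `|h t| <= B) ->
   (\int[lambda]_(t in D) `|(h t)%:E| < +oo)%E.
  move=> hB; apply: (@le_lt_trans _ _ (\int[lambda]_(t in D) (cst B%:E t))%E).
    by apply: ge0_le_integral_nomeas => t Dt; rewrite ?abse_ge0 //= lee_fin hB.
  by rewrite integral_cst // lte_mul_pinfty // lee_fin addr_ge0.
have cM : - `|c| <= c /\ M <= `|M|.
  by split; [have := ler_norm (- c); rewrite normrN; lra|exact: ler_norm].
have fB t : D t -> `|f t| <= B.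
  move=> Dt; rewrite ler_norml /B; have := cf t Dt; have := fg t Dt.
  have := gM t Dt; have := normr_ge0 c; have := normr_ge0 M; lra.
have gB t : D t -> `|g t| <= B.
  move=> Dt; rewrite ler_norml /B; have := cf t Dt; have := fg t Dt.
  have := gM t Dt; have := normr_ge0 c; have := normr_ge0 M; lra.
have finp (h : R -> R) : (forall t, D t -> `|h t| <= B) ->
    (\int[lambda]_(t in D) ((EFin \o h)^\+ t) \is a fin_num)%E /\
    (\int[lambda]_(t in D) ((EFin \o h)^\- t) \is a fin_num)%E.
  move=> hB; split; rewrite ge0_fin_numE.
  - apply: le_lt_trans (bound h hB); apply: ge0_le_integral_nomeas => t _ //.
    by have /(congr1 (@^~ t)) /= -> := fune_abse (EFin \o h); rewrite leeDl.
  - by apply: integral_ge0.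
  - apply: le_lt_trans (bound h hB); apply: ge0_le_integral_nomeas => t _ //.
    by have /(congr1 (@^~ t)) /= -> := fune_abse (EFin \o h); rewrite leeDr.
  - by apply: integral_ge0.
have [fp fn] := finp f fB; have [gp gn] := finp g gB.
rewrite /Rintegral fine_le //.
- by rewrite integralE fin_numB fp.
- by rewrite integralE fin_numB gp.
have fgE : {in D, forall t, ((EFin \o f) t <= (EFin \o g) t)%E}.
  by move=> t; rewrite inE => Dt; rewrite lee_fin fg.
rewrite integralE [leRHS]integralE leeB //;
  apply: ge0_le_integral_nomeas => // t Dt.
  by apply: (funepos_le fgE); rewrite inE.
by apply: (funeneg_le fgE); rewrite inE.
Qed.

End CompletedLebesgue.

(** * Spanning sets of controls *)

Section SteeredControls.
Context {R : realType}.
Local Notation lambda := (@completed_lebesgue_measure R).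

Lemma compact_in_box n (Q : set 'cV[R]_n) : compact Q ->
  exists rho, forall x, Q x -> in_box rho x.
Proof.
move=> /compact_bounded /ex_strict_bound_gt0[M M0 QM]; exists M => x Qx i.
apply: le_trans (ltW (QM x Qx)); rewrite -[leRHS]/(mx_norm x) mx_normrE.
exact: (le_bigmax _ (fun ij : 'I_n * 'I_1 => `|x ij.1 ij.2|) (i, ord0)).
Qed.

Lemma interior_box n (Q : set 'cV[R]_n) x0 : Q° x0 ->
  exists2 r : R, 0 < r & forall y, in_box r y -> Q (x0 + y).
Proof.
move=> /nbhs_ballP[e /= e0 eQ]; exists (e / 2); first by rewrite divr_gt0.
move=> y yr; apply: eQ; split=> // i j; rewrite /ball /= ord1 !mxE.
rewrite opprD addNKr normrN (le_lt_trans (yr i)) //.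
by rewrite ltr_pdivrMr // ltr_pMr // ltr1n.
Qed.

(** The sum of n squares (eps / (1 + n))^2 is below eps^2 because n < (1 + n)^2. *)
Lemma euclidean_dist_lt n (x y : 'cV[R]_n) (eps : R) : 0 < eps ->
  in_box (eps / (1 + n%:R)) (y - x) -> euclidean_dist x y < eps.
Proof.
move=> eps0 xy.
rewrite /euclidean_dist -(ger0_norm (ltW eps0)) -sqrtr_sqr.
rewrite ltr_sqrt ?exprn_gt0 //.
apply: (@le_lt_trans _ _ (\sum_(i < n) (eps / (1 + n%:R)) ^+ 2)).
  apply: ler_sum => i _; rewrite -[leLHS]real_normK ?num_real //.
  rewrite ler_pXn2r ?nnegrE // ?divr_ge0 ?addr_ge0 ?(ltW eps0) //.
  by have := xy i; rewrite !mxE distrC.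
rewrite sumr_const card_ord -[ltLHS]mulr_natl expr_div_n mulrCA.
rewrite gtr_pMr ?exprn_gt0 // ltr_pdivrMr ?exprn_gt0 ?ltr_wpDr // mul1r.
by have := ler0n R n; nra.
Qed.

Lemma nbhd_in_box n (Q : set 'cV[R]_n) (rho eps : R) :
  (forall x, Q x -> in_box rho x) ->
  forall y, nbhd eps Q y -> in_box (rho + eps) y.
Proof.
move=> Qrho y [x Qx xy] i.
have -> : y i 0 = x i 0 - (x i 0 - y i 0) by ring.
rewrite (le_trans (ler_normB _ _)) // lerD ?Qrho //.
apply: le_trans (ltW xy); rewrite -sqrtr_sqr ler_wsqrtr // (bigD1 i) //=.
by rewrite lerDl sumr_ge0 // => k _; exact: sqr_ge0.
Qed.

Lemma cV_subE n (x y : 'cV[R]_n) i : (x - y) i 0 = x i 0 - y i 0.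
Proof. by rewrite !mxE. Qed.

Lemma phiB d m (A : 'M[R]_d) (B : 'M[R]_(d, m)) t x y w :
  phi A B t x w - phi A B t y w = expmx (t *: A) *m (x - y).
Proof. by rewrite /phi mulmxBr opprD addrACA subrr addr0. Qed.

Lemma Rintegral_completed_point (F : R -> R) (a : R) :
  \int[lambda]_(s in `[a, a]) F s = 0.
Proof.
rewrite (@eq_Rintegral _ _ _ _ _ (cst (F a))) => [|s]; last first.
  by rewrite inE /= in_itv /= -eq_le => /eqP <-.
rewrite Rintegral_cst; last exact: measurable_completed_itv.
rewrite [X in fine X](_ : _ = 0%E) ?mulr0 //.
by apply: etrans (completed_lebesgue_measure_itv (lexx a)) _; rewrite subrr.
Qed.

Lemma phi0 d m (A : 'M[R]_d) (B : 'M[R]_(d, m)) x w : phi A B 0 x w = x.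
Proof.
rewrite /phi expmx0 mul1mx [X in _ + X](_ : _ = 0) ?addr0 //.
apply/matrixP => i j; rewrite !mxE.
exact: Rintegral_completed_point.
Qed.

(** Every point of a box around [x0] in [Q] receives a control from [S]. Two points sharing a
    control both end near [Q], so the flow keeps their difference within twice the radius
    [rho + eps], which is what [expanding_count] asks for. *)
Lemma spanning_lower d m (A : 'M[R]_d) (B : 'M[R]_(d, m)) (U : set 'cV[R]_m)
    (Q : set 'cV[R]_d) (x0 : 'cV[R]_d) (eps : R) :
  compact Q -> Q° x0 ->
  exists2 kappa : R, 0 < kappa & forall tau S, 0 <= tau ->
    spanning A B U tau eps Q S -> exists X : seq (R -> 'cV[R]_m),
    [/\ uniq X, forall w, w \in X -> S w &
      kappa * expR (unstable_rate A * tau) <= (size X)%:R].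
Proof.
move=> /compact_in_box[rho /nbhd_in_box Qrho] /interior_box[r r0 Qr].
have [kappa kappa0 count] := expanding_count A (2 * (rho + eps)) r0.
exists kappa => // tau S tau0 [_ Sspan].
have /choice[g gP] : forall x, exists w, in_box r x ->
    S w /\ nbhd eps Q (phi A B tau (x0 + x) w).
  move=> x; have [xr|] := pselect (in_box r x); last by exists (fun=> 0).
  have [w Sw wP] := Sspan _ (Qr x xr); exists w => _; split=> //.
  by apply: wP; rewrite tau0 lexx.
have [|X [uX Xg Xsize]] := count tau tau0 _ g.
  move=> x x' xr x'r gxx' i.
  have -> : x - x' = (x0 + x) - (x0 + x') by rewrite opprD addrACA subrr add0r.
  rewrite -(phiB A B _ _ _ (g x)) cV_subE.
  rewrite (le_trans (ler_normB _ _)) // mulr2n mulrDl mul1r lerD //.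
    exact: (Qrho _ _ (gP x xr).2 i).
  by rewrite gxx'; exact: (Qrho _ _ (gP x' x'r).2 i).
exists X; split=> // w /Xg[x xr ->]; exact: (gP x xr).1.
Qed.

End SteeredControls.

(** * Controls that come to rest at the equilibrium *)

Section RestControl.
Context {R : realType}.
Local Notation lambda := (@completed_lebesgue_measure R).

Lemma is_derive_expmx_mul n p (A : 'M[R]_n) (P : 'M[R]_(n, p)) i j (t : R) :
  is_derive t (1 : R) (fun s => (expmx (s *: A) *m P) i j)
    ((expmx (t *: A) *m (A *m P)) i j).
Proof.
rewrite mulmxA -expmx_comm mxE; under eq_fun do rewrite mxE.
apply: is_derive_sum_ord => k.
have := is_derive_mul (is_derive_expmx A i k t)
  (is_derive_cst (P k j) t (1 : R)).
by rewrite mulr0 addr0.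
Qed.

Lemma continuous_expmx_mul n p (A : 'M[R]_n) (P : 'M[R]_(n, p)) i j (t : R) :
  continuous (fun s : R => (expmx ((t - s) *: A) *m P) i j).
Proof.
move=> s; apply: differentiable_continuous; apply/derivable1_diffP.
by have [] := is_derive_reflect (is_derive_expmx_mul A P i j (t - s)).
Qed.

Lemma integrable_Rsum (D : set (lebesgueR R)) (I : Type) (r : seq I)
    (h : I -> R -> R) : measurable D ->
  (forall i, lambda.-integrable D (EFin \o h i)) ->
  lambda.-integrable D (EFin \o (fun s => \sum_(i <- r) h i s)).
Proof.
move=> mD hi.
have -> : EFin \o (fun s => \sum_(i <- r) h i s) =
    (fun s => \sum_(i <- r) (h i s)%:E)%E.
  by apply/funext => s /=; rewrite sumEFin.
by apply: integrable_sum => // i _; exact: hi.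
Qed.

Lemma Rintegral_sum (D : set (lebesgueR R)) (I : Type) (r : seq I)
    (h : I -> R -> R) : measurable D ->
  (forall i, lambda.-integrable D (EFin \o h i)) ->
  \int[lambda]_(s in D) (\sum_(i <- r) h i s) =
  \sum_(i <- r) \int[lambda]_(s in D) h i s.
Proof.
move=> mD hi; elim: r => [|i r IH].
  rewrite big_nil; under eq_fun do rewrite big_nil.
  by rewrite (Rintegral_cst lambda mD) mul0r.
rewrite big_cons -IH; under eq_fun do rewrite big_cons.
by rewrite RintegralD //; exact: integrable_Rsum.
Qed.

Variables (d m : nat) (A : 'M[R]_d) (B : 'M[R]_(d, m)) (U : set 'cV[R]_m).

Lemma integrable_kernel (w : R -> 'cV[R]_m) (t a b : R) i : controls U w ->
  lambda.-integrable `[a, b]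
    (EFin \o (fun s => (expmx ((t - s) *: A) *m B *m w s) i 0)).
Proof.
move=> [_ wU].
have -> : (fun s => (expmx ((t - s) *: A) *m B *m w s) i 0) =
    fun s => \sum_k (expmx ((t - s) *: A) *m B) i k * w s k 0.
  by apply/funext => s; rewrite mxE.
apply: integrable_Rsum => [|k]; first exact: measurable_completed_itv.
have hc := @continuous_expmx_mul _ _ A B i k t.
have := (wU k).2 a b.
move=> /(integrableMr (measurable_completed_itv _) _ _); apply.
  by apply: measurable_funS (measurable_continuous_completed hc).
exact: continuous_bounded_itv.
Qed.

Lemma controls_switch (w : R -> 'cV[R]_m) (u0 : 'cV[R]_m) (T : R) :
  compact U -> U u0 -> controls U w ->
  controls U (fun s => if s <= T then w s else u0).
Proof.
move=> /compact_in_box[M UM] Uu0 [wU wm]; split=> [t|k]; first by case: ifP.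
have mv : measurable_fun [set: lebesgueR R]
    (fun t : lebesgueR R => (if t <= T then w t else u0) k 0).
  have -> : (fun t : lebesgueR R => (if t <= T then w t else u0) k 0) =
      (fun t : lebesgueR R => if t <= T then w t k 0 else u0 k 0).
    by apply/funext => t; case: ifP.
  apply: measurable_fun_ifT; first exact: measurable_fun_le_completed.
    exact: (wm k).1.
  exact: measurable_cst.
split=> // a b; apply: measurable_bounded_integrable.
- exact: measurable_completed_itv.
- exact: completed_lebesgue_measure_itv_lty.
- exact: measurable_funS mv.
- exists M; split; first exact: num_real.
  move=> y My t _ /=; apply: le_trans (ltW My).
  by apply: UM; case: ifP.
Qed.

(** For t > T the integral is split at [T]. Its head is e^{(t-T)A} applied to the control term at
    time [T]; its tail is x0 - e^{(t-T)A} x0 by the equilibrium equation. With the transported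
    initial value these add up to [x0]. *)
Lemma phi_switch (w : R -> 'cV[R]_m) (u0 : 'cV[R]_m) (x x0 : 'cV[R]_d) (T : R) :
  compact U -> U u0 -> controls U w -> A *m x0 + B *m u0 = 0 ->
  0 <= T -> phi A B T x w = x0 -> forall t,
  phi A B t x (fun s => if s <= T then w s else u0) =
  if t <= T then phi A B t x w else x0.
Proof.
move=> Uc Uu0 wU equil T0 phiT t; set v := fun s => _.
case: ifPn => [tT|]; last rewrite -ltNge => Tt.
  congr (_ + _); apply/matrixP => i j; rewrite !mxE.
  apply: eq_Rintegral => s; rewrite inE /= in_itv /= => /andP[_ st].
  by rewrite /v (le_trans st tT).
have vU : controls U v by exact: controls_switch.
apply/matrixP => i j; rewrite ord1 {j}.
(* An antiderivative of the tail: F'(s) = - e^{(t-s)A} A x0 = e^{(t-s)A} B u0. *)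
pose F s := (expmx ((t - s) *: A) *m x0) i 0.
have Tail : \int[lambda]_(s in `]T, t]) (expmx ((t - s) *: A) *m B *m v s) i 0 =
    x0 i 0 - (expmx ((t - T) *: A) *m x0) i 0.
  transitivity (F t - F T); last by rewrite /F subrr expmx0 mul1mx.
  transitivity (\int[lambda]_(s in `]T, t])
      (expmx ((t - s) *: A) *m (B *m u0)) i 0).
    apply: eq_Rintegral => s; rewrite inE /= in_itv /= => /andP[Ts _].
    by rewrite /v leNgt Ts mulmxA.
  apply: completed_FTC; [exact: ltW|exact: continuous_expmx_mul|] => s.
  have := is_derive_reflect (is_derive_expmx_mul A x0 i 0 (t - s)).
  congr (is_derive _ _ _ _).
  have -> : B *m u0 = - (A *m x0) by apply/eqP; rewrite -addr_eq0 addrC equil.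
  by rewrite mulmxN [RHS]mxE.
have Head : \int[lambda]_(s in `[0, T]) (expmx ((t - s) *: A) *m B *m v s) i 0 =
    \sum_k expmx ((t - T) *: A) i k *
      \int[lambda]_(s in `[0, T]) (expmx ((T - s) *: A) *m B *m w s) k 0.
  pose G k s := expmx ((t - T) *: A) i k *
    (expmx ((T - s) *: A) *m B *m w s) k 0.
  have iG k : lambda.-integrable `[0, T] (EFin \o G k).
    have := integrableZl (measurable_completed_itv _)
      (expmx ((t - T) *: A) i k) (integrable_kernel T 0 T k wU).
    by [].
  transitivity (\int[lambda]_(s in `[0, T]) (\sum_k G k s)).
    apply: eq_Rintegral => s; rewrite inE /= in_itv /= => /andP[_ sT].
    rewrite /v sT -[t](subrK T) -addrA expmxD -!mulmxA mxE.
    by apply: eq_bigr => k _; rewrite /G -!mulmxA.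
  rewrite Rintegral_sum //; last exact: measurable_completed_itv.
  apply: eq_bigr => k _; rewrite /G RintegralZl //.
    exact: measurable_completed_itv.
  exact: integrable_kernel.
have splitE : [set` `[0, t]] = `[0, T] `|` `]T, t] :> set R.
  by rewrite -itv_bndbnd_setU // bnd_simp // ltW.
have x0E k : x0 k 0 = (expmx (T *: A) *m x) k 0 +
    \int[lambda]_(s in `[0, T]) (expmx ((T - s) *: A) *m B *m w s) k 0.
  by rewrite -{1}phiT /phi [LHS]mxE [X in _ + X]mxE.
rewrite /phi [LHS]mxE [X in _ + X]mxE splitE Rintegral_setU.
- rewrite Head Tail.
  have -> : expmx (t *: A) = expmx ((t - T) *: A) *m expmx (T *: A).
    by rewrite -expmxD subrK.
  rewrite -mulmxA.
  have mulE (y : 'cV[R]_d) : (expmx ((t - T) *: A) *m y) i 0 =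
      \sum_k expmx ((t - T) *: A) i k * y k 0 by rewrite mxE.
  have -> : (expmx ((t - T) *: A) *m x0) i 0 =
      (expmx ((t - T) *: A) *m (expmx (T *: A) *m x)) i 0 +
      \sum_k expmx ((t - T) *: A) i k *
        \int[lambda]_(s in `[0, T]) (expmx ((T - s) *: A) *m B *m w s) k 0.
    rewrite !mulE -big_split; apply: eq_bigr => k _ /=.
    by rewrite x0E mulrDr.
  ring.
- exact: measurable_completed_itv.
- exact: measurable_completed_itv.
- rewrite -splitE; exact: integrable_kernel.
- apply/disj_setPS => s [] /=; rewrite !in_itv /= => /andP[_ sT] /andP[Ts _].
  by move: Ts; rewrite ltNge sT.
Qed.

End RestControl.

(** * Separated sets and small spanning sets *)

Section Covering.
Context {R : realType} {d m : nat}.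
Variables (A : 'M[R]_d) (B : 'M[R]_(d, m)) (U : set 'cV[R]_m)
  (Q : set 'cV[R]_d).

Lemma steered_control (u0 : 'cV[R]_m) (x0 : 'cV[R]_d) (T0 : R) :
  compact U -> U u0 -> Q x0 -> A *m x0 + B *m u0 = 0 ->
  (forall x, Q x -> exists T : R, exists w : R -> 'cV[R]_m,
     [/\ 0 < T <= T0, controls U w, phi A B T x w = x0 &
         forall t, 0 < t <= T -> Q (phi A B t x w)]) ->
  forall x, Q x -> exists w : R -> 'cV[R]_m,
    [/\ controls U w, forall t, 0 <= t -> Q (phi A B t x w) &
        forall t, T0 < t -> w t = u0].
Proof.
move=> Uc Uu0 Qx0 equil steer x Qx.
have [T [w [/andP[Tgt0 TT0] wU phiT phiQ]]] := steer x Qx.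
exists (fun s => if s <= T then w s else u0); split.
- exact: controls_switch.
- move=> t t0; rewrite (phi_switch Uc Uu0 wU equil (ltW Tgt0) phiT).
  (* The steering hypothesis speaks of positive times only; at time 0 the state is [x] itself. *)
  case: ifP => // tT; have [->|tn0] := eqVneq t 0; first by rewrite phi0.
  by apply: phiQ; rewrite tT lt_neqAle eq_sym tn0 t0.
- by move=> t T0t; rewrite leNgt (le_lt_trans TT0 T0t).
Qed.

(** The Bowen ball of the linear flow in the sup norm; by [phiB] it compares the solutions from [x]
    and [y] under any common control. *)
Definition stays_close (tau eps : R) (x y : 'cV[R]_d) : Prop :=
  forall t, 0 <= t <= tau -> in_box eps (expmx (t *: A) *m (x - y)).

Lemma stays_closexx tau eps x : 0 <= eps -> stays_close tau eps x x.
Proof. by move=> eps0 t _ i; rewrite subrr mulmx0 mxE normr0. Qed.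

Lemma stays_close_sym tau eps x y :
  stays_close tau eps x y -> stays_close tau eps y x.
Proof.
move=> xy t tt i; have := xy t tt i.
by rewrite -[y - x]opprB mulmxN [X in _ -> `|X| <= _]mxE normrN.
Qed.

(** [separated_count] bounds the size of separated subsets of [Q], so one of maximal size exists; it
    covers, as a point far from all its members could be added. *)
Lemma separated_cover (rho eps delta : R) : 0 < eps -> 0 < delta ->
  (forall x, Q x -> in_box rho x) ->
  exists2 C : R, 0 < C & forall tau, 0 <= tau -> exists E : seq 'cV[R]_d,
    [/\ forall x, x \in E -> Q x,
        forall y, Q y -> exists2 x, x \in E & stays_close tau eps x y &
        (size E)%:R <= C * expR ((unstable_rate A + delta) * tau)].
Proof.
move=> eps0 delta0 Qrho.
have [C C0 count] := separated_count A rho eps0 delta0.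
exists C => // tau tau0.
pose sep (E : seq 'cV[R]_d) := [/\ uniq E, forall x, x \in E -> Q x &
  forall x y, x \in E -> y \in E -> stays_close tau eps x y -> x = y].
pose P n := `[< exists2 E, sep E & size E = n >].
have exP : exists n, P n by exists 0%N; apply/asboolP; exists [::].
have sep_size E : sep E ->
    (size E)%:R <= C * expR ((unstable_rate A + delta) * tau).
  by move=> [uE EQ Esep]; apply: count => // x xE; exact/Qrho/EQ.
have boundP n : P n ->
    (n <= Num.truncn (C * expR ((unstable_rate A + delta) * tau)))%N.
  move=> /asboolP[E sepE <-].
  by rewrite truncn_ge_nat ?sep_size // mulr_ge0 ?expR_ge0 // ltW.
case: (ex_maxnP exP boundP) => n /asboolP[E sepE <-] maxE.
exists E; have [uE EQ Esep] := sepE; split=> //; last exact: sep_size.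
move=> y Qy; apply: contrapT => noclose.
have far x : x \in E -> ~ stays_close tau eps x y.
  by move=> xE xy; apply: noclose; exists x.
suff : P (size (y :: E)) by move=> /maxE; rewrite ltnn.
apply/asboolP; exists (y :: E) => //; split.
- rewrite /= uE andbT; apply/negP => /far; apply.
  by apply: stays_closexx; exact: ltW.
- by move=> x; rewrite inE => /predU1P[->//|]; exact: EQ.
- move=> x z; rewrite !inE => /predU1P[->|xE] /predU1P[->|zE] //.
  + by move=> /stays_close_sym /far; case.
  + by move=> /far; case.
  + exact: Esep.
Qed.

(** The control chosen for a point of the cover keeps that point in [Q] forever, and hence keeps
    every point of [Q] close to it within [eps] of [Q] up to [tau]. *)
Lemma spanning_upper (u0 : 'cV[R]_m) (T0 eps delta : R) :
  compact Q -> 0 < eps -> 0 < delta ->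
  (forall x, Q x -> exists w : R -> 'cV[R]_m,
    [/\ controls U w, forall t, 0 <= t -> Q (phi A B t x w) &
        forall t, T0 < t -> w t = u0]) ->
  exists2 C : R, 0 < C & forall tau, 0 <= tau ->
  exists E : seq (R -> 'cV[R]_m),
    [/\ uniq E, spanning A B U tau eps Q [set` E],
        forall w, w \in E -> forall t, T0 < t -> w t = u0 &
        (size E)%:R <= C * expR ((unstable_rate A + delta) * tau)].
Proof.
move=> /compact_in_box[rho Qrho] eps0 delta0 steer.
have eps'0 : 0 < eps / (1 + d%:R) by rewrite divr_gt0 // ltr_wpDr.
have [C C0 cover] := separated_cover eps'0 delta0 Qrho.
exists C => // tau tau0; have [E [EQ Ecover Esize]] := cover tau tau0.
have /choice[v vP] : forall x, exists w, Q x -> [/\ controls U w,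
    forall t, 0 <= t -> Q (phi A B t x w) & forall t, T0 < t -> w t = u0].
  move=> x; have [Qx|] := pselect (Q x); last by exists (fun=> 0).
  by have [w wP] := steer x Qx; exists w.
(* Different centers may share a control, which must be counted once in a sum over the set. *)
exists (undup (map v E)); split.
- exact: undup_uniq.
- split=> [w /=|y Qy].
    by rewrite mem_undup => /mapP[x /EQ Qx ->]; have [] := vP x Qx.
  have [x xE xy] := Ecover y Qy; have [vU vQ _] := vP x (EQ x xE).
  exists (v x); first by rewrite /= mem_undup map_f.
  move=> t /[dup] tt /andP[t0 _]; exists (phi A B t x (v x)); first exact: vQ.
  apply: euclidean_dist_lt => //; rewrite phiB.
  exact: (stays_close_sym xy).
- by move=> w; rewrite mem_undup => /mapP[x /EQ Qx ->]; have [] := vP x Qx.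
- apply: le_trans Esize; rewrite ler_nat (leq_trans (size_undup _)) //.
  by rewrite size_map.
Qed.

End Covering.

(** * Exponential rates *)

Section ExponentialRates.
Context {R : realType}.
Local Notation lambda := (@completed_lebesgue_measure R).

(** After the logarithm and division by tau, a constant factor c contributes ln c / tau, which tends
    to 0; the slack [delta] is arbitrary. *)
Lemma limf_esup_exp_rate (g : R -> \bar R) (s : R) :
  (exists2 kappa : R, 0 < kappa &
     forall tau, 0 <= tau -> ((kappa * expR (s * tau))%:E <= g tau)%E) ->
  (forall delta : R, 0 < delta -> exists2 C : R, 0 < C &
     forall tau, 0 <= tau -> (g tau <= (C * expR ((s + delta) * tau))%:E)%E) ->
  limf_esup (fun tau : R => (tau^-1)%:E * lne (g tau))%E (pinfty_nbhs R) = s%:E.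
Proof.
move=> [kappa kappa0 low] up.
have lneE (c a tau : R) : 0 < c -> 0 < tau ->
    ((tau^-1)%:E * lne (c * expR (a * tau))%:E)%E = (ln c / tau + a)%:E.
  move=> c0 tau0; rewrite lne_EFin ?mulr_gt0 ?expR_gt0 //.
  rewrite lnM ?posrE ?expR_gt0 // expRK -EFinM mulrDr mulrC; congr (_%:E).
  by congr (_ + _); rewrite mulrC mulfK // gt_eqF.
have pos (c a tau : R) : 0 < c -> (0 <= (c * expR (a * tau))%:E :> \bar R)%E.
  by move=> c0; rewrite lee_fin mulr_ge0 ?expR_ge0 // ltW.
apply/le_anti/andP; split.
  apply/lee_addgt0Pr => e e0.
  have [C C0 gC] := up (e / 2) (divr_gt0 e0 (ltr0n _ 2)).
  apply: ge_ereal_inf; eexists.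
    (* Beyond this threshold |ln C| / tau is below e / 2; the other half of e is the slack in the
       exponent. *)
    exists [set tau : R | 2 * `|ln C| / e < tau] => //.
    by exists (2 * `|ln C| / e); split; first exact: num_real.
  apply: ge_ereal_sup => _ [tau /= tauC <-].
  have tau0 : 0 < tau.
    by apply: le_lt_trans tauC; rewrite divr_ge0 ?mulr_ge0 // ltW.
  apply: (@le_trans _ _
    ((tau^-1)%:E * lne (C * expR ((s + e / 2) * tau))%:E)%E).
    rewrite lee_pmul2l // ?lte_fin ?invr_gt0 // lee_lne ?gC ?(ltW tau0) //.
      rewrite in_itv /= leey andbT.
      by apply: le_trans (low tau (ltW tau0)); exact: pos.
    by rewrite in_itv /= leey andbT pos.
  rewrite lneE // -EFinD lee_fin.
  have H : ln C / tau <= e / 2.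
    rewrite ler_pdivrMr //; apply: le_trans (ler_norm _) _.
    by move: tauC; rewrite ltr_pdivrMr //; lra.
  lra.
apply: le_ereal_inf_tmp => _ [V [M [_ MV]] <-].
apply/lee_addgt0Pr => e e0.
(* A single time inside the given neighbourhood of infinity, large enough for |ln kappa| / tau to be
   below e. *)
pose tau := Num.max `|M| (`|ln kappa| / e) + 1.
have tauM : `|M| < tau by rewrite ltr_pwDr // le_max lexx.
have tauk : `|ln kappa| / e < tau by rewrite ltr_pwDr // le_max lexx orbT.
have tau0 : 0 < tau by exact: le_lt_trans tauM.
rewrite -leeBlDr //; apply: le_ereal_sup_tmp.
exists ((tau^-1)%:E * lne (g tau))%E.
  by exists tau => //; apply: MV; exact: le_lt_trans (ler_norm M) tauM.
apply: (@le_trans _ _ ((tau^-1)%:E * lne (kappa * expR (s * tau))%:E)%E).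
  rewrite lneE // -EFinB lee_fin.
  have H : - e <= ln kappa / tau.
    rewrite ler_pdivlMr //; have := ler_norm (- ln kappa); rewrite normrN.
    by move: tauk; rewrite ltr_pdivrMr //; lra.
  lra.
rewrite lee_pmul2l // ?lte_fin ?invr_gt0 // lee_lne ?low ?(ltW tau0) //.
  by rewrite in_itv /= leey andbT pos.
rewrite in_itv /= leey andbT.
by apply: le_trans (low tau (ltW tau0)); exact: pos.
Qed.

Variables (m : nat) (U : set 'cV[R]_m) (f : 'cV[R]_m -> R) (u0 : 'cV[R]_m).
Hypothesis fmin : forall u, U u -> f u0 <= f u.
Variable M : R.
Hypothesis fmax : forall u, U u -> f u <= M.

Let Rintegral_const (c a b : R) : a <= b ->
  \int[lambda]_(t in `[a, b]) c = c * (b - a).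
Proof.
move=> ab; rewrite (Rintegral_cst lambda (measurable_completed_itv _)).
by congr (_ * _); exact: (congr1 fine (completed_lebesgue_measure_itv ab)).
Qed.

Lemma S_int_ge (w : R -> 'cV[R]_m) (tau : R) : 0 <= tau -> controls U w ->
  f u0 * tau <= S_int f tau w.
Proof.
move=> tau0 [wU _]; have := Rintegral_const (f u0) tau0; rewrite subr0 => <-.
apply: (@le_Rintegral_bounded _ _
  (fun=> f u0) (fun t => f (w t)) (f u0) M) => //.
- exact: measurable_completed_itv.
- exact: completed_lebesgue_measure_itv_lty.
- by move=> t _; exact/fmin/wU.
- by move=> t _; exact/fmax/wU.
Qed.

(** Up to time [T0] the integrand is at most [M], afterwards it equals [f u0]; the excess over f(u0)
    tau does not depend on [tau]. *)
Lemma S_int_le (w : R -> 'cV[R]_m) (T0 tau : R) : U u0 -> 0 <= T0 -> 0 <= tau ->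
  controls U w -> (forall t, T0 < t -> w t = u0) ->
  S_int f tau w <= f u0 * tau + (M - f u0) * T0.
Proof.
move=> Uu0 T00 tau0 [wU _] wrest.
have fM : f u0 <= M by exact: fmax.
have [tauT0|T0tau] := leP tau T0.
  apply: (@le_trans _ _ (\int[lambda]_(t in `[0, tau]) M)).
    apply: (@le_Rintegral_bounded _ _
      (fun t => f (w t)) (fun=> M) (f u0) M) => //.
    - exact: measurable_completed_itv.
    - exact: completed_lebesgue_measure_itv_lty.
    - by move=> t _; exact/fmin/wU.
    - by move=> t _; exact/fmax/wU.
  by rewrite Rintegral_const // subr0; nra.
pose g (t : R) := if t <= T0 then M else f u0.
have gint : lambda.-integrable `[0, tau] (EFin \o g).
  apply: measurable_bounded_integrable.
  - exact: measurable_completed_itv.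
  - exact: completed_lebesgue_measure_itv_lty.
  - apply: measurable_funTS; apply: measurable_fun_ifT.
    + exact: measurable_fun_le_completed.
    + exact: measurable_cst.
    + exact: measurable_cst.
  - exists (`|M| + `|f u0|); split; first exact: num_real.
    move=> y My t _ /=; apply: le_trans (ltW My).
    by rewrite /g; case: ifP => _; rewrite ?lerDl ?lerDr.
have gE : \int[lambda]_(t in `[0, tau]) g t = f u0 * tau + (M - f u0) * T0.
  have splitE : [set` `[0, tau]] = `[0, T0] `|` `]T0, tau] :> set R.
    by rewrite -itv_bndbnd_setU // bnd_simp // ltW.
  rewrite splitE Rintegral_setU.
  - rewrite (@eq_Rintegral _ _ _ _ _ (fun=> M)) => [|t]; last first.
      by rewrite inE /= in_itv /= /g => /andP[_ ->].
    rewrite Rintegral_const // (@eq_Rintegral _ _ _ _ _ (fun=> f u0)) => [|t];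
      last first.
      by rewrite inE /= in_itv /= /g => /andP[T0t _]; rewrite leNgt T0t.
    have lin s : is_derive s (1 : R) (fun r => f u0 * r) (f u0).
      have := is_deriveZ (f u0) (is_derive_id s (1 : R)).
      by rewrite [_ *: 1]mulr1.
    rewrite (completed_FTC (ltW T0tau) _ lin); last exact: cst_continuous.
    ring.
  - exact: measurable_completed_itv.
  - exact: measurable_completed_itv.
  - by rewrite -splitE.
  - apply/disj_setPS => s [] /=; rewrite !in_itv /= => /andP[_ sT] /andP[Ts _].
    by move: Ts; rewrite ltNge sT.
rewrite -gE.
apply: (@le_Rintegral_bounded _ _ (fun t => f (w t)) g (f u0) M) => //.
- exact: measurable_completed_itv.
- exact: completed_lebesgue_measure_itv_lty.
- by move=> t _; exact/fmin/wU.
- move=> t _; rewrite /g; case: ifPn => [_|]; first exact/fmax/wU.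
  by rewrite -ltNge => /wrest ->.
- by move=> t _; rewrite /g; case: ifP.
Qed.

End ExponentialRates.

(** * Bounds on the minimal cardinality and the minimal weighted sum *)

Section MinimalSpanning.
Context {R : realType} {d m : nat}.
Variables (A : 'M[R]_d) (B : 'M[R]_(d, m)) (U : set 'cV[R]_m)
  (Q : set 'cV[R]_d) (f : 'cV[R]_m -> R) (u0 : 'cV[R]_m) (T0 M : R).
Hypotheses (fmin : forall u, U u -> f u0 <= f u)
  (fmax : forall u, U u -> f u <= M).
Implicit Types (tau eps c : R) (S : set (R -> 'cV[R]_m)).

(** A spanning set of n elements contains the distinct members of [X]; without finite spanning sets
    the infimum is infinite. *)
Lemma le_r_inv tau eps c :
  (forall S, spanning A B U tau eps Q S -> exists X : seq (R -> 'cV[R]_m),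
    [/\ uniq X, forall w, w \in X -> S w & c <= (size X)%:R]) ->
  (c%:E <= r_inv A B U tau eps Q)%E.
Proof.
move=> low; apply: le_ereal_inf_tmp => _ [n /= [S Sspan Sn] <-].
have [X [uX XS]] := low S Sspan; rewrite lee_fin => /le_trans; apply.
have finS : finite_set S by apply/finite_setP; exists n.
rewrite ler_nat -(card_fset_set Sn); apply: uniq_leq_size => // w wX.
by rewrite in_fset_set // inE; exact: XS.
Qed.

Lemma r_inv_le tau eps c (E : seq (R -> 'cV[R]_m)) :
  spanning A B U tau eps Q [set` E] -> (size E)%:R <= c ->
  (r_inv A B U tau eps Q <= c%:E)%E.
Proof.
move=> Espan Ec; have finE : finite_set [set` E] := finite_seq E.
have /finite_setP[n En] := finE.
apply: ge_ereal_inf; exists n%:R%:E; first by exists n => //; exists [set` E].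
rewrite lee_fin; apply: le_trans Ec; rewrite ler_nat -(card_fset_set En).
by apply: uniq_leq_size => // w; rewrite in_fset_set // inE.
Qed.

(** The sum over [S], possibly infinite, dominates its part over [X], where each term is at least
    e^{f(u0) tau}. *)
Lemma le_a_inv tau eps c : 0 <= tau ->
  (forall S, spanning A B U tau eps Q S -> exists X : seq (R -> 'cV[R]_m),
    [/\ uniq X, forall w, w \in X -> S w & c <= (size X)%:R]) ->
  ((c * expR (f u0 * tau))%:E <= a_inv A B U tau eps f Q)%E.
Proof.
move=> tau0 low; apply: le_ereal_inf_tmp => _ [S /= Sspan <-].
have [X [uX XS cX]] := low S Sspan.
apply: esum_ge; exists [set` X]; first by split; [exact: finite_seq|exact: XS].
rewrite -fsbig_seq // sumEFin lee_fin.
apply: (@le_trans _ _ ((size X)%:R * expR (f u0 * tau))).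
  by rewrite ler_wpM2r ?expR_ge0.
have -> : (size X)%:R * expR (f u0 * tau) = \sum_(w <- X) expR (f u0 * tau).
  by rewrite big_const_seq count_predT iter_addr_0 mulr_natl.
rewrite big_seq [leRHS]big_seq; apply: ler_sum => w wX.
rewrite ler_expR.
exact: (S_int_ge fmin fmax tau0 (Sspan.1 _ (XS w wX))).
Qed.

Lemma a_inv_le tau eps c (E : seq (R -> 'cV[R]_m)) : U u0 -> 0 <= T0 ->
  0 <= tau -> uniq E -> spanning A B U tau eps Q [set` E] ->
  (forall w, w \in E -> forall t, T0 < t -> w t = u0) -> (size E)%:R <= c ->
  (a_inv A B U tau eps f Q <=
    (c * expR (f u0 * tau + (M - f u0) * T0))%:E)%E.
Proof.
move=> Uu0 T00 tau0 uE Espan Erest Ec; apply: ge_ereal_inf; eexists.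
  by exists [set` E].
rewrite esum_fset; last 2 first.
- exact: finite_seq.
- by move=> w _; rewrite lee_fin expR_ge0.
rewrite -fsbig_seq // sumEFin lee_fin.
apply: (@le_trans _ _
  ((size E)%:R * expR (f u0 * tau + (M - f u0) * T0))); last first.
  by rewrite ler_wpM2r ?expR_ge0.
have -> : (size E)%:R * expR (f u0 * tau + (M - f u0) * T0) =
    \sum_(w <- E) expR (f u0 * tau + (M - f u0) * T0).
  by rewrite big_const_seq count_predT iter_addr_0 mulr_natl.
rewrite big_seq [leRHS]big_seq; apply: ler_sum => w wE.
rewrite ler_expR.
exact: (S_int_le fmin fmax Uu0 T00 tau0 (Espan.1 _ wE) (Erest w wE)).
Qed.

End MinimalSpanning.

Theorem theorem27 (R : realType) (d m : nat)
  (A : 'M[R]_d) (B : 'M[R]_(d, m))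
  (U : set 'cV[R]_m) (Ucompact : compact U) (Uconvex : convex_set U)
  (Uint : U° !=set0)
  (Q : set 'cV[R]_d) (Qcompact : compact Q)
  (f : 'cV[R]_m -> R) (fcont : {within U, continuous f})
  (u0 : 'cV[R]_m) (x0 : 'cV[R]_d)
  (Uu0 : U u0) (Qx0 : Q° x0)
  (fmin : forall u, U u -> f u0 <= f u)
  (equil : A *m x0 + B *m u0 = 0)
  (steer : exists2 T0 : R, 0 < T0 &
     forall x, Q x -> exists T : R, exists w : R -> 'cV[R]_m,
       [/\ 0 < T <= T0, controls U w, phi A B T x w = x0 &
           forall t, 0 < t <= T -> Q (phi A B t x w)]) :
  P_out A B U f Q = ((f u0)%:E + h_inv_out A B U Q)%E /\
  ((f u0)%:E + h_inv_out A B U Q)%E =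
    (f u0 + \sum_(mu <- eigenvalues A) Num.max 0 (complex.Re mu))%:E.
Proof.
have [T0 T00 steerT] := steer.
have steered := steered_control Ucompact Uu0 (interior_subset Qx0) equil steerT.
have [M fmax] : exists M, forall u, U u -> f u <= M.
  have [|c _ cmax] := compact_EVT_max _ Ucompact fcont; first by exists u0.
  by exists (f c) => u Uu; apply: cmax; rewrite inE.
(* The rate is already exact at every positive [eps], before any limit. *)
have hE eps : 0 < eps -> h_inv A B U eps Q = (unstable_rate A)%:E.
  move=> eps0; apply: limf_esup_exp_rate => [|delta delta0].
    have [kappa kappa0 low] := spanning_lower A B U eps Qcompact Qx0.
    exists kappa => // tau tau0; apply: le_r_inv => S; exact: low.
  have [C C0 up] := spanning_upper Qcompact eps0 delta0 steered.
  exists C => // tau tau0; have [E [_ Espan _ Esize]] := up tau tau0.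
  exact: r_inv_le Espan Esize.
have PE eps : 0 < eps -> P_inv A B U eps f Q = (f u0 + unstable_rate A)%:E.
  move=> eps0; apply: limf_esup_exp_rate => [|delta delta0].
    have [kappa kappa0 low] := spanning_lower A B U eps Qcompact Qx0.
    exists kappa => // tau tau0.
    rewrite mulrDl addrC expRD mulrA.
    by apply: (le_a_inv fmin fmax) => // S; exact: low.
  have [C C0 up] := spanning_upper Qcompact eps0 delta0 steered.
  (* The bounded excess of the integral of [f] before rest becomes a constant factor, invisible to
     the rate. *)
  exists (C * expR ((M - f u0) * T0)); first by rewrite mulr_gt0 ?expR_gt0.
  move=> tau tau0; have [E [uE Espan Erest Esize]] := up tau tau0.
  have := a_inv_le fmin fmax Uu0 (ltW T00) tau0 uE Espan Erest Esize.
  rewrite -!mulrA -!expRD; congr (_ <= (_ * expR _)%:E)%E; ring.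
(* Only positive [eps] matter for a right limit at 0, and there both quantities are constant. *)
have limE (h : R -> \bar R) (l : \bar R) : (forall eps, 0 < eps -> h eps = l) ->
    lim (h eps @[eps --> 0^'+]) = l.
  move=> hl; apply: lim_near_cst; first exact: ereal_hausdorff.
  by near=> eps; apply: hl.
rewrite /P_out /h_inv_out (limE _ _ PE) (limE _ _ hE) -EFinD.
by [].
Unshelve. all: by end_near.
Qed.
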